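(* Let $\psi$ be a translationally invariant pure gapped ground state for $H$, the Hamiltonian determined by a self-adjoint even local element $h$. If $\psi$ has string order, then $\psi$ cannot be connected to the standard Fock state $\psi_F$ by any one-parameter group of automorphisms $\alpha_t^{h'}$, i.e. $$\psi\circ\alpha_t^{h'}\neq\psi_F$$ for every $t\in\mathbf R$ and every self-adjoint even $h'\in\mathfrak A_{loc}$.
   Context: $\mathfrak A$ is the CAR algebra ($C^*$-algebra) generated by $c_j^*,c_j$ ($j\in\mathbf Z$) with $\{c_i,c_j\}=\{c_i^*,c_j^*\}=0$, $\{c_j^*,c_i\}=\delta_{i,j}1$. The parity automorphism $\Theta$ is determined by $\Theta(c_j)=-c_j$; $\mathfrak A^{(\pm)}=\{Q\in\mathfrak A:\Theta(Q)=\pm Q\}$; elements of $\mathfrak A^{(+)}$ are called even. $\mathfrak A_{[n,m]}$ is the subalgebra generated by $c_j,c_j^*$, $n\le j\le m$; $\mathfrak A_{loc}=\bigcup_{n<m}\mathfrak A_{[n,m]}$; $\mathfrak A^{(\pm)}_{[n,m]}=\mathfrak A_{[n,m]}\cap\mathfrak A^{(\pm)}$. The lattice translation $\tau_k$ is the automorphism with $\tau_k(c_i)=c_{i+k}$; a state is translationally invariant if it is $\tau_k$-invariant for all $k\in\mathbf Z$. For $h=h^*\in\mathfrak A^{(+)}_{[-n,n]}$ ($n>1$), set $H_M=\sum_{-M+n\le k\le M-n}\tau_k(h)$, formally $H=\lim_{M\to\infty}H_M$, $[H,Q]=\lim_{M\to\infty}[H_M,Q]$ for $Q\in\mathfrak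 A_{loc}$, and $\alpha_t^h(Q)=\lim_{M\to\infty}e^{itH_M}Qe^{-itH_M}$ for $Q\in\mathfrak A$. The automorphism group $\alpha_t^{h'}$ is defined in the same way from $h'$. A translationally invariant state $\psi$ is a ground state of $H$ if $\psi(h)=\inf\varphi(h)$, the infimum over all translationally invariant states $\varphi$. It is gapped if there is $m>0$ with $\psi(Q^*[H,Q])\ge m(\psi(Q^*Q)-|\psi(Q)|^2)$ for all $Q\in\mathfrak A_{loc}$. String order. Put $S[0,k-1]=\prod_{j=0}^{k-1}(2c_j^*c_j-1)$. A translationally invariant pure state $\psi$ has string order if there are integers $n<0\le m$ and elements $Q_1\in\mathfrak A^{(-)}\cap\mathfrak A_{[n,-1]}$, $Q_2\in\mathfrak A^{(-)}\cap\mathfrak A_{[0,m]}$ such that $$\lim_{k\to\infty}\psi\bigl(Q_1\,S[0,2k-1]\,\tau_{2k}(Q_2)\bigr)\neq0 .$$ The standard Fock state $\psi_F$ is the unique state of $\mathfrak A$ with $\psi_F(c_j^*c_j)=0$ for all $j\in\mathbf Z$. *)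

(* Defs.v *)
From HB Require Import structures.
From mathcomp Require Import all_boot all_order all_algebra.
From mathcomp Require Import complex.
From mathcomp Require Import all_classical all_reals all_analysis.

Set Implicit Arguments.
Unset Strict Implicit.
Unset Printing Implicit Defensive.

Import Order.TTheory GRing.Theory Num.Theory.
Import numFieldNormedType.Exports.

Local Open Scope classical_set_scope.
Local Open Scope ring_scope.

(* Unital C*-algebras.  The norm of a normedModType R[i] takes its (nonnegative
   real) values in R[i].  This is a record and not a join of the structures
   algType and completeNormedModType because numDomainType, which is already the
   join of rings and normed types, rules that join out; the algebra structure is
   attached to the carrier below. *)
Record cstarAlgType (R : realType) := CStarAlgebra {
  cstar_carrier : completeNormedModType R[i];
  cstar_one : cstar_carrier;
  cstar_mul : cstar_carrier -> cstar_carrier -> cstar_carrier;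
  cstar_star : cstar_carrier -> cstar_carrier;
  cstar_mulA : associative cstar_mul;
  cstar_mul1 : left_id cstar_one cstar_mul;
  cstar_mulr1 : right_id cstar_one cstar_mul;
  cstar_mulDl : left_distributive cstar_mul +%R;
  cstar_mulDr : right_distributive cstar_mul +%R;
  cstar_one_neq0 : cstar_one != 0;
  cstar_scaleAl : forall (z : R[i]) a b,
    z *: cstar_mul a b = cstar_mul (z *: a) b;
  cstar_scaleAr : forall (z : R[i]) a b,
    z *: cstar_mul a b = cstar_mul a (z *: b);
  cstar_starK : involutive cstar_star;
  cstar_starD : {morph cstar_star : a b / a + b};
  cstar_starZ : forall (z : R[i]) a,
    cstar_star (z *: a) = (z^*)%R *: cstar_star a;
  cstar_starM : forall a b,
    cstar_star (cstar_mul a b) = cstar_mul (cstar_star b) (cstar_star a);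
  cstar_normM : forall a b, `|cstar_mul a b| <= `|a| * `|b|;
  cstar_norm : forall a, `|cstar_mul (cstar_star a) a| = `|a| ^+ 2
}.

Definition cstar_sort (R : realType) (A : cstarAlgType R) : Type :=
  cstar_carrier A.
Coercion cstar_sort : cstarAlgType >-> Sortclass.

Section CStarAlgebraInstances.
Context (R : realType) (A : cstarAlgType R).

HB.instance Definition _ :=
  CompleteNormedModule.copy (cstar_sort A) (cstar_carrier A).
HB.instance Definition _ := GRing.Zmodule_isNzRing.Build (cstar_sort A)
  (@cstar_mulA _ A) (@cstar_mul1 _ A) (@cstar_mulr1 _ A)
  (@cstar_mulDl _ A) (@cstar_mulDr _ A) (@cstar_one_neq0 _ A).
HB.instance Definition _ :=
  GRing.Lmodule_isLalgebra.Build R[i] (cstar_sort A) (@cstar_scaleAl _ A).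
HB.instance Definition _ :=
  GRing.Lalgebra_isAlgebra.Build R[i] (cstar_sort A) (@cstar_scaleAr _ A).

Definition star (a : A) : A := @cstar_star _ A a.

End CStarAlgebraInstances.

Section Car.
Context (R : realType) (A : cstarAlgType R).
Implicit Types (c : int -> A) (Theta : {lrmorphism A -> A})
  (tau : int -> {lrmorphism A -> A}) (psi phi : {scalar A}).

Definition commutator (a b : A) : A := a * b - b * a.
Definition anticommutator (a b : A) : A := a * b + b * a.

Definition car_relations c :=
  [/\ forall i j, anticommutator (c i) (c j) = 0,
      forall i j, anticommutator (star (c i)) (star (c j)) = 0
    & forall i j, anticommutator (star (c j)) (c i) = (i == j)%:R].

Definition local_subalg c (n m : int) : set A :=
  smallest (fun S : set A => GRing.subalg_closed [in S])
    [set a | exists2 j, n <= j <= m & a = c j \/ a = star (c j)].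

Definition Aloc c : set A :=
  [set a | exists n m : int, n < m /\ local_subalg c n m a].

(* The CAR relations fix the C*-algebra generated by the c_j up to
   isomorphism, so a statement about the CAR algebra is a statement about every
   A and c with [is_car_algebra c]. *)
Definition is_car_algebra c := car_relations c /\ closure (Aloc c) = setT.

Definition star_automorphism (f : {lrmorphism A -> A}) :=
  bijective f /\ {morph f : a / star a}.

Definition is_parity c Theta :=
  star_automorphism Theta /\ forall j, Theta (c j) = - c j.

Definition is_translation c tau :=
  forall k, star_automorphism (tau k) /\ forall i, tau k (c i) = c (i + k).

Definition even_part Theta : set A := [set Q | Theta Q = Q].
Definition odd_part Theta : set A := [set Q | Theta Q = - Q].

(* In R[i], 0 <= z means that z is real and nonnegative, and x <= y means
   0 <= y - x; this is the order used here and in [gapped]. *)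
Definition is_state psi :=
  (forall a, 0 <= psi (star a * a)) /\ psi 1 = 1.

Definition translation_invariant tau psi := forall k a, psi (tau k a) = psi a.

Definition invariant_state tau psi :=
  is_state psi /\ translation_invariant tau psi.

Definition pure_state psi :=
  is_state psi /\
  forall (phi1 phi2 : {scalar A}) (s : R), is_state phi1 -> is_state phi2 ->
    0 < s < 1 ->
    (forall a, psi a = s%:C%C * phi1 a + (1 - s)%:C%C * phi2 a) ->
    phi1 =1 psi /\ phi2 =1 psi.

Definition is_fock c psi :=
  is_state psi /\ forall j, psi (star (c j) * c j) = 0.

Definition local_interaction c Theta (n : nat) (h : A) :=
  [/\ (1 < n)%N, star h = h, even_part Theta h
    & local_subalg c (- n%:Z) n%:Z h].

Definition hamiltonian tau (n : nat) (h : A) (M : nat) : A :=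
  \sum_(k \in [set k : int | - M%:Z + n%:Z <= k <= M%:Z - n%:Z]) tau k h.

(* The formal commutator [H, Q] for Q in Aloc; there the sequence is eventually
   constant. *)
Definition derivation tau (n : nat) (h Q : A) : A :=
  lim (commutator (hamiltonian tau n h M) Q @[M --> \oo]).

Definition cstar_exp (a : A) : A :=
  lim (series (fun k => (k`!%:R : R[i])^-1 *: a ^+ k) @ \oo).

(* alpha_t^h(Q), with e^{itH_M} written U t M. *)
Definition evolution tau (n : nat) (h : A) (t : R) (Q : A) : A :=
  let U (s : R) M := cstar_exp (('i * s%:C%C) *: hamiltonian tau n h M) in
  lim (U t M * Q * U (- t) M @[M --> \oo]).

(* phi h is real for a state phi and a selfadjoint h. *)
Definition ground_state tau (h : A) psi :=
  invariant_state tau psi /\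
  complex.Re (psi h) =
    inf [set complex.Re (phi h) | phi in invariant_state tau].

Definition gapped c tau (n : nat) (h : A) psi :=
  exists2 m : R, 0 < m & forall Q, Aloc c Q ->
    m%:C%C * (psi (star Q * Q) - `|psi Q| ^+ 2)
      <= psi (star Q * derivation tau n h Q).

(* S[0, k - 1] *)
Definition string_op c (k : nat) : A :=
  \prod_(0 <= j < k) (2 *: (star (c j%:Z) * c j%:Z) - 1).

(* ^o selects the library's norm topology on the field R[i]. *)
Definition string_order c Theta tau psi :=
  exists (n m : int) (Q1 Q2 : A) (l : R[i]),
    [/\ n < 0 <= m,
        (odd_part Theta `&` local_subalg c n (-1)) Q1,
        (odd_part Theta `&` local_subalg c 0 m) Q2,
        (psi (Q1 * string_op c (2 * k)%N * tau (2 * k)%N%:Z Q2) : R[i]^o)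
          @[k --> \oo] --> (l : R[i]^o)
      & l != 0].

End Car.

(* Main.v *)
(* If psi o alpha_t = psi_F then the string correlator psi(X_k) equals
   psi_F(alpha_{-t}(X_k)).  The Fock state is invariant under conjugation by
   F = S[-k, k - 1], whereas F alpha(X_k) F is close to - alpha(X_k): with
   alpha = alpha_{-t}, the factor alpha(Q_1) is quasi-local near 0 and odd, hence
   changes sign; alpha(tau_{2k} Q_2) is quasi-local near 2k, hence commutes with
   F; and alpha(S[0, 2k - 1]) almost commutes with F because, by Duhamel's
   formula, F only perturbs the Hamiltonian by even terms near the sites -k and
   k, which stay quasi-local under the evolution and so commute up to a small
   error with S[0, 2k - 1], whose edges are far away.  Therefore psi(X_k) tends to
   0.  All estimates are uniform in the finite volume that defines the
   evolution. *)

Require Import Defs.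
From HB Require Import structures.
From mathcomp Require Import all_boot all_order all_algebra.
From mathcomp Require Import complex.
From mathcomp Require Import all_classical all_reals all_analysis.
From mathcomp Require Import ring lra zify.

Import Order.TTheory GRing.Theory Num.Theory.
Import numFieldNormedType.Exports.

Local Open Scope classical_set_scope.
Local Open Scope ring_scope.

Set Implicit Arguments.
Unset Strict Implicit.
Unset Printing Implicit Defensive.

(** The obstacle is the string: its support has length 2k, so no locality estimate uniform in k
    applies to its evolution. It therefore enters Duhamel's formula only as a fixed element of norm
    1, and locality is asked only of the boundedly many terms of the Hamiltonian that F changes. The
    edges -k and k of F have distance at least k from the edges 0 and 2k of the string, so one large
    k serves all three factors.

    Locality comes from truncating the commutator series of e^{itH} Q e^{-itH}. The estimates are
    uniform in the volume only for short times; longer times are reached by composing short steps. A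
    string acts on a truncation by a sign only if the parity of the truncation is known, so a parity
    eigenvalue is carried along with every support.

    Duhamel's integral is replaced by a telescoping product over small time steps. States are
    defined by positivity alone, so their boundedness has to be derived; the crude constant 4 is
    enough because the norm that it multiplies tends to 0. *)

Section RealNorm.
Context (R : realType) (A : cstarAlgType R).
Implicit Types (a b x y : A) (u v : nat -> A) (e : R).

(** The norm of [A] takes values in the partially ordered [R[i]]; by [rnormE] its real part loses
    nothing, and it makes real arithmetic available. *)
Definition rnorm a : R := complex.Re `|a|.

Lemma rnormE a : `|a| = (rnorm a)%:C%C.
Proof. by rewrite /rnorm RRe_real // ger0_real. Qed.

Lemma rnorm_ge0 a : 0 <= rnorm a.
Proof. by rewrite -ler0c -rnormE. Qed.

Lemma rnorm0 : rnorm 0 = 0.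
Proof. by rewrite /rnorm normr0. Qed.

Lemma rnorm0_eq0 a : rnorm a = 0 -> a = 0.
Proof. by move=> a0; apply/eqP; rewrite -normr_eq0 rnormE a0. Qed.

Lemma rnormN a : rnorm (- a) = rnorm a.
Proof. by rewrite /rnorm normrN. Qed.

Lemma rnorm_sub_sym a b : rnorm (a - b) = rnorm (b - a).
Proof. by rewrite /rnorm distrC. Qed.

Lemma rnormD a b : rnorm (a + b) <= rnorm a + rnorm b.
Proof. by rewrite -lecR rmorphD /= -!rnormE ler_normD. Qed.

Lemma rnormB a b : rnorm (a - b) <= rnorm a + rnorm b.
Proof. by rewrite -(rnormN b) rnormD. Qed.

Lemma rnorm_dist a b c : rnorm (a - c) <= rnorm (a - b) + rnorm (b - c).
Proof. by rewrite (_ : a - c = (a - b) + (b - c)) ?rnormD // addrA subrK. Qed.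

Lemma rnormM a b : rnorm (a * b) <= rnorm a * rnorm b.
Proof. by rewrite -lecR rmorphM /= -!rnormE; exact: (@cstar_normM _ A). Qed.

Lemma rnormZ (z : R[i]) a : rnorm (z *: a) = complex.Re `|z| * rnorm a.
Proof.
by rewrite {1}/rnorm normrZ rnormE -{1}(@RRe_real _ `|z|) ?ger0_real // -rmorphM.
Qed.

Lemma rnormM3 a b c : rnorm (a * b * c) <= rnorm a * rnorm b * rnorm c.
Proof. by rewrite (le_trans (rnormM _ _)) // ler_wpM2r ?rnorm_ge0 ?rnormM. Qed.

Lemma rnorm_sum (I : Type) (s : seq I) (P : pred I) (F : I -> A) :
  rnorm (\sum_(i <- s | P i) F i) <= \sum_(i <- s | P i) rnorm (F i).
Proof.
elim/big_rec2: _ => [|i y1 y2 _ le12]; first by rewrite rnorm0.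
by rewrite (le_trans (rnormD _ _)) // lerD2l.
Qed.

Lemma starK a : star (star a) = a. Proof. exact: cstar_starK. Qed.
Lemma starD a b : star (a + b) = star a + star b. Proof. exact: cstar_starD. Qed.
Lemma starM a b : star (a * b) = star b * star a. Proof. exact: cstar_starM. Qed.
Lemma starZ (z : R[i]) a : star (z *: a) = (z^*)%R *: star a.
Proof. exact: cstar_starZ. Qed.

Lemma star0 : star (0 : A) = 0.
Proof. by have := starZ 0 (0 : A); rewrite conjC0 !scale0r. Qed.

Lemma starN a : star (- a) = - star a.
Proof. by rewrite -scaleN1r starZ rmorphN rmorph1 scaleN1r. Qed.

Lemma starB a b : star (a - b) = star a - star b.
Proof. by rewrite starD starN. Qed.

Lemma star1 : star (1 : A) = 1.
Proof. by rewrite -[RHS]starK -[star 1 in RHS]mulr1 starM starK mulr1. Qed.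

Lemma star_sum (I : Type) (s : seq I) (P : pred I) (F : I -> A) :
  star (\sum_(i <- s | P i) F i) = \sum_(i <- s | P i) star (F i).
Proof. exact: (big_morph _ starD star0). Qed.

Lemma starX a k : star (a ^+ k) = star a ^+ k.
Proof. by elim: k => [|k IH]; rewrite ?star1 // exprS starM IH exprSr. Qed.

Lemma rnorm_starM a : rnorm (star a * a) = rnorm a ^+ 2.
Proof.
apply: (@complexI R); rewrite rmorphXn /= -!rnormE.
exact: (@cstar_norm _ A).
Qed.

Lemma rnorm_star a : rnorm (star a) = rnorm a.
Proof.
suff le b : rnorm b <= rnorm (star b).
  by apply/eqP; rewrite eq_le le andbT -{2}(starK a) le.
have [b0|b0] := leP (rnorm b) 0.
  by rewrite (le_trans b0) // rnorm_ge0.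
by rewrite -(ler_pM2r b0) -expr2 -rnorm_starM rnormM.
Qed.

Lemma rnorm1 : rnorm 1 = 1.
Proof.
have := rnorm_starM 1; rewrite star1 mulr1 expr2 => /esym/eqP.
rewrite -subr_eq0 -{3}(mulr1 (rnorm 1)) -mulrBr mulf_eq0 subr_eq0.
case/orP => /eqP // /rnorm0_eq0 /eqP; by rewrite oner_eq0.
Qed.

Lemma rnorm_unitary a : star a * a = 1 -> rnorm a = 1.
Proof.
move=> aa; have := rnorm_starM a; rewrite aa rnorm1 => /esym/eqP.
by rewrite sqrf_eq1 => /orP[/eqP//|/eqP a1]; have := rnorm_ge0 a; rewrite a1; lra.
Qed.

Lemma rnormX a k : rnorm (a ^+ k) <= rnorm a ^+ k.
Proof.
elim: k => [|k IH]; first by rewrite !expr0 rnorm1.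
by rewrite !exprS (le_trans (rnormM _ _)) // ler_wpM2l ?rnorm_ge0.
Qed.

Lemma rnorm_unit_conj x y a : rnorm x <= 1 -> rnorm y <= 1 ->
  rnorm (x * a * y) <= rnorm a.
Proof.
move=> x1 y1; rewrite (le_trans (rnormM3 _ _ _)) //.
rewrite -[leRHS]mulr1 ler_pM ?mulr_ge0 ?rnorm_ge0 //.
by rewrite -[leRHS]mul1r ler_pM ?rnorm_ge0.
Qed.

(** Explicit thresholds and a real [e] make estimates that are uniform in the volume easy to
    combine; [seq_to_cvg] and [cvg_seq_to] show the equivalence with filter convergence. *)
Definition seq_to u a :=
  forall e, 0 < e -> exists N, forall n, (N <= n)%N -> rnorm (u n - a) <= e.

Lemma seq_to_cvg u a : seq_to u a -> u n @[n --> \oo] --> a.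
Proof.
move=> ua; apply/cvgrPdist_le => z z0.
have zr : z = (complex.Re z)%:C%C by rewrite RRe_real // gtr0_real.
have [|N NP] := ua (complex.Re z); first by rewrite -ltcR -zr.
exists N => // k /= Nk; rewrite rnormE zr lecR rnorm_sub_sym; exact: NP.
Qed.

Lemma cvg_seq_to u a : u n @[n --> \oo] --> a -> seq_to u a.
Proof.
move=> /cvgrPdist_le ua e e0.
have [|N _ NP] := ua e%:C%C; first by rewrite ltcR.
exists N => k Nk; rewrite rnorm_sub_sym -lecR -rnormE; exact: NP.
Qed.

Lemma seq_to_lim u a : seq_to u a -> lim (u n @[n --> \oo]) = a.
Proof. by move/seq_to_cvg/cvg_lim; apply; exact: norm_hausdorff. Qed.

Lemma seq_to_unique u a b : seq_to u a -> seq_to u b -> a = b.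
Proof. by move=> /seq_to_lim <- /seq_to_lim <-. Qed.

Lemma cauchy_seq_to u :
  (forall e, 0 < e -> exists N, forall n m, (N <= n)%N -> (N <= m)%N ->
     rnorm (u n - u m) <= e) -> exists a, seq_to u a.
Proof.
move=> uC; suff : cvg (u n @[n --> \oo]) by move/cvg_seq_to => ?; eexists; eauto.
apply/cauchy_cvgP/cauchy_ballP => z z0.
have zr : z = (complex.Re z)%:C%C by rewrite RRe_real // gtr0_real.
have e0 : 0 < complex.Re z by rewrite -ltcR -zr.
have [|N NP] := uC (complex.Re z / 2); first by rewrite divr_gt0.
rewrite near_map2; exists ([set k | (N <= k)%N], [set k | (N <= k)%N]).
  by split; exists N.
move=> [p q] [/= Np Nq]; rewrite -ball_normE /= rnormE zr ltcR.
rewrite (@le_lt_trans _ _ (complex.Re z / 2)) ?NP //.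
by rewrite ltr_pdivrMr // ltr_pMr // ltr1n.
Qed.

Lemma seq_to_le u a (B : R) : seq_to u a -> (exists N, forall n, (N <= n)%N ->
  rnorm (u n) <= B) -> rnorm a <= B.
Proof.
move=> ua [N uB]; apply/ler_addgt0Pr => e e0.
have [N' NP] := ua e e0.
rewrite (_ : a = u (maxn N N') - (u (maxn N N') - a)); last by rewrite subKr.
by rewrite (le_trans (rnormB _ _)) // lerD ?uB ?NP // ?leq_maxl ?leq_maxr.
Qed.

Lemma seq_to_const a : seq_to (fun=> a) a.
Proof. by move=> e e0; exists 0%N => n _; rewrite subrr rnorm0 ltW. Qed.

Lemma seq_toB u v a b : seq_to u a -> seq_to v b ->
  seq_to (fun n => u n - v n) (a - b).
Proof.
move=> ua vb e e0; have e2 : 0 < e / 2 by rewrite divr_gt0.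
have [N NP] := ua _ e2; have [M MP] := vb _ e2.
exists (maxn N M) => k; rewrite geq_max => /andP[Nk Mk].
rewrite opprD addrACA -opprD.
by rewrite (le_trans (rnormB _ _)) // [leRHS]splitr lerD ?NP ?MP.
Qed.

Lemma seq_to_mull u a x y : seq_to u a -> seq_to (fun n => x * u n * y) (x * a * y).
Proof.
move=> ua e e0; have K0 : 0 < rnorm x * rnorm y + 1.
  by rewrite ltr_wpDl ?mulr_ge0 ?rnorm_ge0.
have [|N NP] := ua (e / (rnorm x * rnorm y + 1)); first by rewrite divr_gt0.
exists N => k Nk; rewrite -mulrBl -mulrBr (le_trans (rnormM3 _ _ _)) //.
rewrite mulrAC.
rewrite (le_trans _ (_ : (rnorm x * rnorm y + 1) * (e / (rnorm x * rnorm y + 1)) <= _)) //.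
  by rewrite ler_pM ?mulr_ge0 ?rnorm_ge0 ?lerDl ?NP.
by rewrite mulrC divfK // gt_eqF.
Qed.

Lemma seq_to_star u a : seq_to u a -> seq_to (fun n => star (u n)) (star a).
Proof.
move=> ua e e0; have [N NP] := ua e e0.
by exists N => k Nk; rewrite -starB rnorm_star NP.
Qed.

Lemma seq_to_ext u v a : u =1 v -> seq_to u a -> seq_to v a.
Proof. by move=> uv ua e e0; have [N NP] := ua e e0; exists N => k; rewrite -uv; exact: NP. Qed.

End RealNorm.

(** * Cauchy products of exponential series *)

Section Triangular.
Context (K : numFieldType) (V : algType K).
Implicit Types (x y Q : V).

Definition exp_term x k : V := (k`!%:R : K)^-1 *: x ^+ k.

Lemma exp_term0 x : exp_term x 0 = 1.
Proof. by rewrite /exp_term fact0 invr1 scale1r expr0. Qed.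

Lemma exp_termS x k : k.+1%:R *: exp_term x k.+1 = x * exp_term x k.
Proof.
rewrite /exp_term scalerA factS natrM invfM mulrA divff ?mul1r; last first.
  by rewrite pnatr_eq0.
by rewrite -scalerAr exprS.
Qed.

Lemma exp_termSr x k : k.+1%:R *: exp_term x k.+1 = exp_term x k * x.
Proof. by rewrite exp_termS /exp_term -scalerAr -scalerAl -exprS exprSr. Qed.

(** The homogeneous part of degree m of e^x Q e^y. With y = -x it becomes an m-fold commutator over
    m!, with Q = 1 and commuting x, y the m-th term of e^{x+y}. The field is general because the
    real case is needed as well. *)
Definition exp_conv x y Q m : V :=
  \sum_(0 <= k < m.+1) exp_term x k * Q * exp_term y (m - k).

Lemma exp_convS x y Q m :
  m.+1%:R *: exp_conv x y Q m.+1 = x * exp_conv x y Q m + exp_conv x y Q m * y.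
Proof.
rewrite /exp_conv scaler_sumr.
(* The factor m+1 is split as k + (m+1-k) in each term: the first weight extracts a factor [x] on
   the left, the second a factor [y] on the right. *)
transitivity (\sum_(0 <= k < m.+2)
  (k%:R *: (exp_term x k * Q * exp_term y (m.+1 - k)) +
   (m.+1 - k)%:R *: (exp_term x k * Q * exp_term y (m.+1 - k)))).
  by apply: eq_big_nat => k /andP[_ km]; rewrite -scalerDl -natrD subnKC.
rewrite big_split /=; congr (_ + _).
  rewrite big_nat_recl // scale0r add0r mulr_sumr; apply: eq_bigr => k _.
  by rewrite subSS !scalerAl exp_termS !mulrA.
rewrite big_nat_recr //= subnn scale0r addr0 mulr_suml.
apply: eq_big_nat => k /andP[_ km].
by rewrite subSn // scalerAr exp_termSr !mulrA.
Qed.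

Lemma exp_conv_iter x y Q m :
  exp_conv x y Q m = (m`!%:R : K)^-1 *: iter m (fun P => x * P + P * y) Q.
Proof.
elim: m => [|m IH].
  by rewrite /exp_conv big_nat1 subnn !exp_term0 mul1r mulr1 fact0 invr1 scale1r.
have m0 : m.+1%:R != 0 :> K by rewrite pnatr_eq0.
apply: (scalerI m0); rewrite exp_convS IH factS natrM invfM scalerA mulrA.
by rewrite divff // mul1r -scalerAr -scalerAl -scalerDr.
Qed.

Lemma exp_convD x y m : x * y = y * x -> exp_conv x y 1 m = exp_term (x + y) m.
Proof.
move=> xy; rewrite exp_conv_iter /exp_term; congr (_ *: _).
elim: m => [|m IH]; rewrite ?expr0 //= IH exprS mulrDl; congr (_ + _).
by apply/commr_sym/commrX/commrD; [exact/esym | exact: commr_refl].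
Qed.

Lemma exp_conv_ad x Q m : exp_conv x (- x) Q m =
  (m`!%:R : K)^-1 *: iter m (fun P => x * P - P * x) Q.
Proof.
rewrite exp_conv_iter; congr (_ *: _); apply: eq_iter => P /=.
by rewrite mulrN.
Qed.

End Triangular.

Lemma triangular_sum (V : nmodType) (f : nat -> nat -> V) n :
  \sum_(0 <= k < n) \sum_(0 <= l < n - k) f k l =
  \sum_(0 <= m < n) \sum_(0 <= k < m.+1) f k (m - k)%N.
Proof.
elim: n => [|n IH]; first by rewrite !big_nil.
rewrite [RHS]big_nat_recr //= -IH [LHS]big_nat_recr //= subSn // subnn big_nat1.
have -> : \sum_(0 <= k < n.+1) f k (n - k)%N =
    \sum_(0 <= k < n) f k (n - k)%N + f n 0%N by rewrite big_nat_recr //= subnn.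
rewrite addrA -big_split /=; congr (_ + _).
apply: eq_big_nat => k /andP[_ kn].
by rewrite subSn ?big_nat_recr // ltnW.
Qed.

Lemma square_sum (V : nmodType) (f : nat -> nat -> V) n :
  \sum_(0 <= k < n) \sum_(0 <= l < n) f k l =
  \sum_(0 <= k < n) \sum_(0 <= l < n - k) f k l +
  \sum_(0 <= k < n) \sum_(n - k <= l < n) f k l.
Proof.
rewrite -big_split /=; apply: eq_bigr => k _.
by rewrite -big_cat_nat // leq_subr.
Qed.

Section RealExp.
Context (R : realType).
Implicit Types a b : R.

Lemma cvg_real_cauchy (v : nat -> R) : cvgn v -> forall e, 0 < e ->
  exists N, forall n m, (N <= n)%N -> (N <= m)%N -> `|v n - v m| <= e.
Proof.
move=> /cvg_ex[l /cvgrPdist_le vl] e e0.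
have [|N _ NP] := vl (e / 2); first by rewrite divr_gt0.
exists N => n m Nn Nm; rewrite (_ : v n - v m = (l - v m) - (l - v n)); last by ring.
by rewrite (le_trans (ler_normB _ _)) // [leRHS]splitr lerD //; exact: NP.
Qed.

(** The upper half of the square is the product of the partial sums of e^a and e^b minus the partial
    sum of e^{a+b}, so it vanishes in the limit by the exponential law in [R]. It is the majorant
    for the same sum in [A]. *)
Lemma exp_square_tail a b : forall e, 0 < e -> exists N, forall n, (N <= n)%N ->
  `|\sum_(0 <= k < n) \sum_(n - k <= l < n)
     exp_coeff a k * exp_coeff b l| <= e.
Proof.
move=> e e0.
have tE n : \sum_(0 <= k < n) \sum_(n - k <= l < n) exp_coeff a k * exp_coeff b l
   = series (exp_coeff a) n * series (exp_coeff b) n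
     - series (exp_coeff (a + b)) n.
  suff -> : series (exp_coeff a) n * series (exp_coeff b) n =
      series (exp_coeff (a + b)) n +
      \sum_(0 <= k < n) \sum_(n - k <= l < n) exp_coeff a k * exp_coeff b l.
    by rewrite addrAC subrr add0r.
  rewrite /series mulr_suml.
  under eq_bigr do rewrite mulr_sumr.
  rewrite square_sum; congr (_ + _).
  rewrite triangular_sum; apply: eq_bigr => m _.
  have := @exp_convD R R^o a b m (mulrC _ _).
  rewrite /exp_conv /exp_term /exp_coeff /= /GRing.scale /= => E.
  rewrite mulrC -E; apply: eq_bigr => k _.
  by rewrite mulr1 ![_^-1 * _]mulrC.
have : (fun n => series (exp_coeff a) n * series (exp_coeff b) n
     - series (exp_coeff (a + b)) n) @ \oo --> expR a * expR b - expR (a + b).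
  by apply: cvgB; [apply: cvgM|]; exact: is_cvg_series_exp_coeff.
rewrite expRD subrr => /cvgrPdist_le /(_ e e0)[N _ NP]; exists N => n Nn.
by have := NP n Nn; rewrite /= sub0r normrN tE.
Qed.

End RealExp.

(** * The exponential in a C*-algebra *)

Section Exponential.
Context (R : realType) (A : cstarAlgType R).
Implicit Types (a b x y Q : A) (u : nat -> A).

Lemma normc_invn n : complex.Re `|(n%:R : R[i])^-1| = n%:R^-1.
Proof.
have -> : (n%:R : R[i])^-1 = (n%:R^-1)%:C%C by rewrite fmorphV rmorph_nat.
by rewrite ger0_norm // ler0c invr_ge0.
Qed.

Lemma rnorm_exp_term x k : rnorm (exp_term x k) <= exp_coeff (rnorm x) k.
Proof.
rewrite rnormZ normc_invn /exp_coeff /= mulrC.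
by rewrite ler_wpM2r ?invr_ge0 ?rnormX.
Qed.

Lemma dominated_series u (v : nat -> R) :
  (forall k, rnorm (u k) <= v k) -> cvgn (series v) ->
  exists a, seq_to (series u) a.
Proof.
move=> uv cv; apply: cauchy_seq_to => e e0.
have [N NP] := cvg_real_cauchy cv e0.
suff H n m : (N <= n)%N -> (n <= m)%N -> rnorm (series u m - series u n) <= e.
  exists N => n m Nn Nm; have [nm|/ltnW nm] := leqP n m; last exact: H.
  by rewrite rnorm_sub_sym H.
move=> Nn nm; rewrite sub_series_geq // (le_trans (rnorm_sum _ _ _)) //.
rewrite (le_trans _ (NP m n _ _)) // ?(leq_trans Nn) //.
by rewrite sub_series_geq // (le_trans _ (ler_norm _)) // ler_sum.
Qed.

Lemma cstar_exp_to x : seq_to (series (exp_term x)) (cstar_exp x).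
Proof.
have [a xa] : exists a, seq_to (series (exp_term x)) a.
  apply: (@dominated_series _ (exp_coeff (rnorm x))).
    exact: rnorm_exp_term.
  exact: is_cvg_series_exp_coeff.
rewrite (_ : cstar_exp x = a) //.
by rewrite /cstar_exp; exact: (seq_to_lim xa).
Qed.

Lemma seq_to_bounded u a : seq_to u a ->
  exists2 B, 0 <= B & exists N, forall n, (N <= n)%N -> rnorm (u n) <= B.
Proof.
move=> ua; have [N NP] := ua 1 ltr01.
exists (rnorm a + 1); first by rewrite addr_ge0 ?rnorm_ge0.
exists N => n Nn; rewrite -(subrK a (u n)) addrC.
by rewrite (le_trans (rnormD _ _)) // lerD2l NP.
Qed.

Lemma seq_toM (u v : nat -> A) a b : seq_to u a -> seq_to v b ->
  seq_to (fun n => u n * v n) (a * b).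
Proof.
move=> ua vb e e0; have [B B0 [N NP]] := seq_to_bounded vb.
have B1 : 0 < B + 1 by rewrite ltr_wpDl.
have a1 : 0 < rnorm a + 1 by rewrite ltr_wpDl ?rnorm_ge0.
have [|N1 N1P] := ua (e / 2 / (B + 1)); first by rewrite !divr_gt0.
have [|N2 N2P] := vb (e / 2 / (rnorm a + 1)); first by rewrite !divr_gt0.
exists (maxn N (maxn N1 N2)) => n; rewrite !geq_max => /and3P[nN n1 n2].
rewrite (_ : _ - _ = (u n - a) * v n + a * (v n - b)); last first.
  by rewrite mulrBl mulrBr addrA subrK.
rewrite (le_trans (rnormD _ _)) // [leRHS]splitr lerD //.
  rewrite (le_trans (rnormM _ _)) //.
  rewrite -[leRHS](@divfK _ (B + 1)) ?gt_eqF // ler_pM ?rnorm_ge0 ?N1P //.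
  by rewrite (le_trans (NP _ nN)) // lerDl.
rewrite (le_trans (rnormM _ _)) // mulrC.
rewrite -[leRHS](@divfK _ (rnorm a + 1)) ?gt_eqF // ler_pM ?rnorm_ge0 ?N2P //.
by rewrite lerDl.
Qed.

Lemma exp_conv_to x y Q :
  seq_to (series (exp_conv x y Q)) (cstar_exp x * Q * cstar_exp y).
Proof.
have := seq_toM (seq_toM (cstar_exp_to x) (seq_to_const Q)) (cstar_exp_to y).
move=> H e e0; have e2 : 0 < e / 2 by rewrite divr_gt0.
have q1 : 0 < rnorm Q + 1 by rewrite ltr_wpDl ?rnorm_ge0.
have [N NP] := H _ e2.
have [|M MP] := @exp_square_tail R (rnorm x) (rnorm y) (e / 2 / (rnorm Q + 1)).
  by rewrite divr_gt0.
exists (maxn N M) => n; rewrite geq_max => /andP[Nn Mn].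
rewrite (le_trans (rnorm_dist _ (series (exp_term x) n * Q * series (exp_term y) n) _)) //.
rewrite [leRHS]splitr lerD ?NP // rnorm_sub_sym.
(* The product of partial sums runs over a square of indices, the series of [exp_conv] over the
   triangle k + l < n; the rest is dominated by [exp_square_tail]. *)
have -> : series (exp_term x) n * Q * series (exp_term y) n =
    series (exp_conv x y Q) n + \sum_(0 <= k < n) \sum_(n - k <= l < n)
      exp_term x k * Q * exp_term y l.
  rewrite /series /exp_conv /= 
    -(triangular_sum (fun k l => exp_term x k * Q * exp_term y l)).
  rewrite -square_sum !mulr_suml.
  by apply: eq_bigr => k _; rewrite mulr_sumr.
rewrite addrAC subrr add0r.
rewrite -[leRHS](@divfK _ (rnorm Q + 1)) ?gt_eqF //.
rewrite (le_trans _ (_ : (\sum_(0 <= k < n) \sum_(n - k <= l < n)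
  exp_coeff (rnorm x) k * exp_coeff (rnorm y) l) * rnorm Q <= _)) //; last first.
  rewrite ler_pM ?rnorm_ge0 ?lerDl //.
    by do 2!apply: sumr_ge0 => ? _; rewrite mulr_ge0 ?exp_coeff_ge0 ?rnorm_ge0.
  by rewrite (le_trans (ler_norm _)) // MP.
rewrite mulr_suml (le_trans (rnorm_sum _ _ _)) // ler_sum // => k _.
rewrite mulr_suml (le_trans (rnorm_sum _ _ _)) // ler_sum // => l _.
rewrite (le_trans (rnormM3 _ _ _)) // mulrAC ler_wpM2r ?rnorm_ge0 //.
by rewrite ler_pM ?rnorm_ge0 ?rnorm_exp_term.
Qed.

Lemma cstar_expD x y : x * y = y * x ->
  cstar_exp (x + y) = cstar_exp x * cstar_exp y.
Proof.
move=> xy; rewrite -[cstar_exp x]mulr1.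
apply: (seq_to_unique (cstar_exp_to (x + y))).
apply: seq_to_ext (exp_conv_to x y 1) => n.
by apply: eq_bigr => m _; rewrite exp_convD.
Qed.

Lemma cstar_exp0 : cstar_exp (0 : A) = 1.
Proof.
apply: (seq_to_unique (cstar_exp_to 0)) => e e0; exists 1%N => -[//|n] _.
rewrite /series /= big_nat_recl // exp_term0 big1 ?addr0 ?subrr ?rnorm0 ?ltW //.
by move=> k _; rewrite /exp_term expr0n scaler0.
Qed.

Lemma cstar_expN x : cstar_exp x * cstar_exp (- x) = 1.
Proof. by rewrite -cstar_expD ?subrr ?cstar_exp0 // mulrN mulNr. Qed.

Lemma cstar_expNr x : cstar_exp (- x) * cstar_exp x = 1.
Proof. by have := cstar_expN (- x); rewrite opprK. Qed.

Lemma star_cstar_exp x : star (cstar_exp x) = cstar_exp (star x).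
Proof.
apply: seq_to_unique (cstar_exp_to (star x)).
apply: seq_to_ext (seq_to_star (cstar_exp_to x)) => n.
rewrite /series /= star_sum; apply: eq_bigr => k _.
by rewrite /exp_term starZ starX fmorphV rmorph_nat.
Qed.

Lemma cstar_exp_conj x y z : x * y = 1 -> y * x = 1 ->
  x * cstar_exp z * y = cstar_exp (x * z * y).
Proof.
move=> xy yx; apply: seq_to_unique (cstar_exp_to (x * z * y)).
apply: seq_to_ext (seq_to_mull x y (cstar_exp_to z)) => n.
rewrite /series /= mulr_sumr mulr_suml; apply: eq_bigr => k _.
rewrite /exp_term -scalerAr -scalerAl; congr (_ *: _).
elim: k => [|k IH]; first by rewrite !expr0 mulr1.
by rewrite exprS [RHS]exprS -IH !mulrA -(mulrA _ y x) yx mulr1.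
Qed.

Lemma geometric_tail u a (B : R) p : seq_to (series u) a ->
  (forall m, (p <= m)%N -> rnorm (u m) <= B * 2^-1 ^+ m) ->
  rnorm (a - series u p) <= 2 * B * 2^-1 ^+ p.
Proof.
move=> ua uB.
have := seq_toB ua (seq_to_const (series u p)).
move=> /seq_to_le; apply; exists p => n pn; rewrite sub_series_geq //.
have B0 : 0 <= B.
  have := uB p (leqnn p); move/(le_trans (rnorm_ge0 _)).
  by rewrite pmulr_lge0 // exprn_gt0 // invr_gt0.
rewrite (le_trans (rnorm_sum _ _ _)) //.
rewrite (@le_trans _ _ (\sum_(p <= m < n) B * 2^-1 ^+ m)) //.
  by rewrite big_nat [leRHS]big_nat ler_sum // => m /andP[pm _]; exact: uB.
rewrite -mulr_sumr mulrAC mulrC ler_wpM2r //.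
rewrite (@le_trans _ _ (2 * (2^-1 ^+ p - 2^-1 ^+ n))) //; last first.
  by rewrite ler_wpM2l // gerBl exprn_ge0 // invr_ge0.
rewrite le_eqVlt; apply/orP; left; apply/eqP.
elim: n pn => [|n IH]; first by rewrite leqn0 => /eqP ->; rewrite big_nil; ring.
rewrite leq_eqVlt => /orP[/eqP <-|]; first by rewrite big_geq // subrr mulr0.
by rewrite ltnS => pn; rewrite big_nat_recr //= IH // exprS; field.
Qed.

End Exponential.

(** * Local subalgebras, CAR relations and parity strings *)

Section LocalAlgebra.
Context (R : realType) (A : cstarAlgType R) (c : int -> A).
Implicit Types (P Q : A) (n m i j k : int).
Local Notation loc := (local_subalg c).

Lemma local_ind (n m : int) (T : A -> Prop) : T 1 ->
  (forall (z : R[i]) a b, T a -> T b -> T (z *: a + b)) ->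
  (forall a b, T a -> T b -> T (a * b)) ->
  (forall j, n <= j <= m -> T (c j) /\ T (star (c j))) ->
  forall Q, loc n m Q -> T Q.
Proof.
move=> T1 TD TM Tc Q /(_ [set a | T a]); apply; split.
  split=> [|z a b|a b]; rewrite !inE //=; first exact: TD.
  exact: TM.
by move=> a [j /Tc[Tj Tsj]] [->|->].
Qed.

Lemma loc1 n m : loc n m 1.
Proof. by move=> S [[S1 _ _] _]; rewrite !inE in S1. Qed.

Lemma loc_lin n m (z : R[i]) a b : loc n m a -> loc n m b -> loc n m (z *: a + b).
Proof.
move=> la lb S SP; have [[_ + _] _] := SP => /(_ z a b); rewrite !inE; apply.
  exact: la.
exact: lb.
Qed.

Lemma locM n m a b : loc n m a -> loc n m b -> loc n m (a * b).
Proof.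
move=> la lb S SP; have [[_ _ +] _] := SP => /(_ a b); rewrite !inE; apply.
  exact: la.
exact: lb.
Qed.

Lemma loc_c n m j : n <= j <= m -> loc n m (c j).
Proof. by move=> nj S [_]; apply; exists j => //; left. Qed.

Lemma loc_sc n m j : n <= j <= m -> loc n m (star (c j)).
Proof. by move=> nj S [_]; apply; exists j => //; right. Qed.

Lemma loc0 n m : loc n m 0.
Proof. by rewrite -(subrr 1) -scaleN1r addrC; apply: loc_lin; exact: loc1. Qed.

Lemma locD n m a b : loc n m a -> loc n m b -> loc n m (a + b).
Proof. by rewrite -{2}(scale1r a); exact: loc_lin. Qed.

Lemma locZ n m (z : R[i]) a : loc n m a -> loc n m (z *: a).
Proof. by move=> la; rewrite -(addr0 (z *: a)); apply: loc_lin => //; exact: loc0. Qed.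

Lemma locB n m a b : loc n m a -> loc n m b -> loc n m (a - b).
Proof. by move=> la lb; rewrite -scaleN1r addrC; exact: loc_lin. Qed.

Lemma loc_sum n m (I : eqType) (s : seq I) (F : I -> A) :
  (forall x, x \in s -> loc n m (F x)) -> loc n m (\sum_(x <- s) F x).
Proof. by move=> sF; rewrite big_seq; elim/big_ind: _ => //; [exact: loc0 | exact: locD]. Qed.

Lemma loc_mono n m n' m' a : n' <= n -> m <= m' -> loc n m a -> loc n' m' a.
Proof.
move=> nn mm; move: a; apply: local_ind.
- exact: loc1.
- by move=> ? ? ?; exact: loc_lin.
- by move=> ? ?; exact: locM.
- move=> j /andP[nj jm]; have jn : n' <= j <= m' by rewrite (le_trans nn) ?(le_trans jm).
  by split; [exact: loc_c | exact: loc_sc].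
Qed.

Context (car : car_relations c).

Lemma carC i j : c i * c j = - (c j * c i).
Proof. by have [+ _ _] := car => /(_ i j)/eqP; rewrite addr_eq0 => /eqP. Qed.

Lemma carSS i j : star (c i) * star (c j) = - (star (c j) * star (c i)).
Proof. by have [_ + _] := car => /(_ i j)/eqP; rewrite addr_eq0 => /eqP. Qed.

Lemma carS i j : star (c j) * c i = (i == j)%:R - c i * star (c j).
Proof. by have [_ _ +] := car => /(_ i j) <-; rewrite /anticommutator addrK. Qed.

Lemma anti_sq0 (a : A) : a = - a -> a = 0.
Proof.
move=> /eqP; rewrite -subr_eq0 opprK -mulr2n -scaler_nat scaler_eq0 pnatr_eq0.
by move/eqP.
Qed.

Lemma c_sq0 j : c j * c j = 0. Proof. exact/anti_sq0/carC. Qed.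
Lemma sc_sq0 j : star (c j) * star (c j) = 0. Proof. exact/anti_sq0/carSS. Qed.

Lemma c_sc_c j : c j * star (c j) * c j = c j.
Proof. by rewrite -mulrA carS eqxx mulrBr mulr1 mulrA c_sq0 mul0r subr0. Qed.

Lemma sc_c_sc j : star (c j) * c j * star (c j) = star (c j).
Proof. by rewrite carS eqxx mulrBl mul1r -mulrA sc_sq0 mulr0 subr0. Qed.

(** [star (c j) * c j] is a projection, hence of norm at most 1, and the C*-identity passes the
    bound to [c j]. *)
Lemma rnorm_c j : rnorm (c j) <= 1.
Proof.
have E : rnorm (star (c j) * c j) ^+ 2 = rnorm (star (c j) * c j).
  rewrite -rnorm_starM; congr rnorm.
  by rewrite starM starK mulrA sc_c_sc.
have p1 : rnorm (star (c j) * c j) <= 1.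
  have := rnorm_ge0 (star (c j) * c j); rewrite le_eqVlt => /orP[/eqP<-//|p0].
  by rewrite -(ler_pM2r p0) mul1r -expr2 E.
by rewrite -(@ler_pXn2r _ 2) ?nnegrE ?rnorm_ge0 // expr1n -rnorm_starM.
Qed.

(** A self-adjoint unitary with value 1 on an occupied and -1 on an empty site; it is the factor of
    [string_op]. *)
Definition site_parity j : A := 2 *: (star (c j) * c j) - 1.

Lemma star_site_parity j : star (site_parity j) = site_parity j.
Proof. by rewrite starB star1 starZ starM starK conj_Creal // ger0_real. Qed.

Lemma site_parity_c i j :
  site_parity i * c j = ((-1) ^+ (i == j) : R[i]) *: (c j * site_parity i).
Proof.
rewrite /site_parity mulrBl mulrBr mul1r mulr1 -scalerAl -scalerAr.
have [<-|ij] := eqVneq i j.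
  rewrite -mulrA c_sq0 mulr0 scaler0 mulrA c_sc_c expr1 scaleN1r sub0r.
  by rewrite scaler_nat mulr2n addrK.
rewrite expr0 scale1r; congr (_ *: _ - _).
rewrite -(mulrA (star (c i))) (carC i j) mulrN mulrA (carS j i) eq_sym.
by rewrite (negbTE ij) sub0r mulNr opprK mulrA.
Qed.

Lemma star_eq (a b : A) : star a = star b -> a = b.
Proof. by move/(congr1 (@star R A)); rewrite !starK. Qed.

Lemma sign_conj (e : bool) : (((-1) ^+ e : R[i])^*)%R = (-1) ^+ e.
Proof. by rewrite rmorphXn rmorphN1. Qed.

Lemma commut_star (e : bool) (a b : A) : star a = a ->
  a * b = ((-1) ^+ e : R[i]) *: (b * a) ->
  a * star b = ((-1) ^+ e : R[i]) *: (star b * a).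
Proof.
move=> sa ab; apply: star_eq; rewrite starM starZ sign_conj !starM starK sa ab.
by rewrite scalerA -exprD addnn -signr_odd odd_double scale1r.
Qed.

Lemma site_parity_sq j : site_parity j * site_parity j = 1.
Proof.
rewrite {2}/site_parity mulrBr mulr1 -scalerAr mulrA.
have -> : site_parity j * star (c j) = star (c j).
  rewrite /site_parity mulrBl mul1r -scalerAl sc_c_sc.
  by rewrite scaler_nat mulr2n addrK.
by rewrite /site_parity opprB addrC subrK.
Qed.

(** Start and length are parameters so that both S[0, 2k - 1] and F are instances; the last site is
    a + len - 1. *)
Definition parity_string (a : int) (len : nat) : A :=
  \prod_(0 <= j < len) site_parity (a + j%:Z).

Lemma parity_stringS a len :
  parity_string a len.+1 = parity_string a len * site_parity (a + len%:Z).
Proof. by rewrite /parity_string big_nat_recr. Qed.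

Lemma parity_string0 a : parity_string a 0 = 1.
Proof. by rewrite /parity_string big_nil. Qed.

Lemma string_opE (k : nat) : string_op c k = parity_string 0 k.
Proof. by apply: eq_bigr => j _; rewrite add0r. Qed.

Lemma parity_string_c a len j : parity_string a len * c j =
  ((-1) ^+ ((a <= j) && (j < a + len%:Z)) : R[i]) *: (c j * parity_string a len).
Proof.
elim: len => [|len IH].
  rewrite parity_string0 mul1r mulr1 addr0.
  rewrite (_ : (a <= j) && (j < a) = false); last by lia.
  by rewrite expr0 scale1r.
rewrite parity_stringS -mulrA site_parity_c -scalerAr.
rewrite (mulrA (parity_string a len) (c j)) IH -scalerAl scalerA.
rewrite -signr_addb mulrA; congr ((-1) ^+ _ *: _).
have [<-|ne] := eqVneq (a + len%:Z) j; lia.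
Qed.

Lemma parity_string_site a len j :
  parity_string a len * site_parity j = site_parity j * parity_string a len.
Proof.
elim: len => [|len IH]; first by rewrite parity_string0 mul1r mulr1.
rewrite parity_stringS -mulrA.
suff -> : site_parity (a + len) * site_parity j =
    site_parity j * site_parity (a + len) by rewrite mulrA IH mulrA.
have cj := site_parity_c (a + len) j.
have scj := commut_star (star_site_parity (a + len)) cj.
move: (site_parity (a + len)) cj scj => s cj scj.
rewrite /site_parity mulrBr mulrBl mulr1 mul1r -scalerAr -scalerAl.
congr (_ *: _ - _); rewrite mulrA scj -scalerAl -mulrA cj -scalerAr scalerA mulrA.
by rewrite -exprD addnn -signr_odd odd_double scale1r.
Qed.

Lemma parity_string_sq a len : parity_string a len * parity_string a len = 1.
Proof.
elim: len => [|len IH]; first by rewrite parity_string0 mul1r.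
rewrite parity_stringS {2}parity_string_site -!mulrA.
by rewrite (mulrA (site_parity _)) site_parity_sq mul1r.
Qed.

Lemma star_parity_string a len : star (parity_string a len) = parity_string a len.
Proof.
elim: len => [|len IH]; first by rewrite parity_string0 star1.
by rewrite parity_stringS starM IH star_site_parity parity_string_site.
Qed.

Lemma rnorm_parity_string a len : rnorm (parity_string a len) = 1.
Proof. by apply: rnorm_unitary; rewrite star_parity_string parity_string_sq. Qed.

Lemma parity_stringC a len a' len' : parity_string a len * parity_string a' len' =
  parity_string a' len' * parity_string a len.
Proof.
elim: len' => [|len' IH]; first by rewrite parity_string0 mul1r mulr1.
by rewrite parity_stringS mulrA IH -!mulrA parity_string_site.
Qed.

Lemma parity_string_sc a len j : parity_string a len * star (c j) =
  ((-1) ^+ ((a <= j) && (j < a + len%:Z)) : R[i]) *: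
  (star (c j) * parity_string a len).
Proof. exact/commut_star/parity_string_c/star_parity_string. Qed.

(** Each factor is bilinear in the generators of its own site and so commutes with those of all
    other sites; [Q] may have any parity. *)
Lemma parity_string_outside a len n m Q : loc n m Q ->
  (m < a) || (a + len%:Z <= n) ->
  parity_string a len * Q = Q * parity_string a len.
Proof.
move=> lQ out; move: Q lQ; apply: local_ind.
- by rewrite mulr1 mul1r.
- by move=> z P Q PE QE; rewrite mulrDl mulrDr -scalerAr PE QE scalerAl.
- by move=> P Q PE QE; rewrite mulrA PE -mulrA QE mulrA.
- move=> j jnm; rewrite parity_string_c parity_string_sc.
  rewrite (_ : (a <= j) && (j < a + len%:Z) = false); last by lia.
  by rewrite expr0 !scale1r.
Qed.

Lemma parity_string_conj_loc a len n m Q : loc n m Q ->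
  loc n m (parity_string a len * Q * parity_string a len).
Proof.
move: Q; apply: local_ind.
- by rewrite mulr1 parity_string_sq; exact: loc1.
- move=> z P Q lP lQ; rewrite mulrDr mulrDl -scalerAr -scalerAl.
  exact: loc_lin.
- move=> P Q lP lQ.
  have := locM lP lQ; rewrite -!mulrA (mulrA (parity_string a len) (parity_string a len)).
  by rewrite parity_string_sq mul1r !mulrA.
- move=> j jnm; rewrite parity_string_c parity_string_sc -!scalerAl.
  rewrite -!(mulrA _ (parity_string a len)) parity_string_sq !mulr1.
  by split; apply: locZ; [exact: loc_c | exact: loc_sc].
Qed.

Context (Theta : {lrmorphism A -> A}).
Context (parity : is_parity c Theta).

Lemma Theta_c j : Theta (c j) = - c j. Proof. by case: parity. Qed.
Lemma Theta_sc j : Theta (star (c j)) = - star (c j).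
Proof. by have [[_ ->]] := parity; rewrite Theta_c starN. Qed.

(** Conjugation by a string that covers the support implements [Theta]: both are multiplicative and
    change the sign of every generator there. *)
Lemma parity_string_inside a len n m Q : loc n m Q ->
  (a <= n) && (m < a + len%:Z) ->
  parity_string a len * Q = Theta Q * parity_string a len.
Proof.
move=> lQ ins; move: Q lQ; apply: local_ind.
- by rewrite rmorph1 mulr1 mul1r.
- move=> z P Q PE QE.
  by rewrite linearP /= mulrDl mulrDr -scalerAr PE QE scalerAl.
- by move=> P Q PE QE; rewrite rmorphM mulrA PE -(mulrA _ _ Q) QE mulrA.
- move=> j jnm; rewrite parity_string_c parity_string_sc Theta_c Theta_sc.
  have -> : (a <= j) && (j < a + len%:Z) = true by lia.
  by rewrite expr1 !scaleN1r !mulNr.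
Qed.

Lemma even_local_comm n m n' m' P Q : loc n m P -> Theta P = P ->
  loc n' m' Q -> (m < n') || (m' < n) -> P * Q = Q * P.
Proof.
move=> lP eP lQ dis.
(* Evenness of [P] is not inherited by its factors, so the induction proves the graded relation P
   c_j = c_j Theta(P) for all [P]; evenness is used only at the end. *)
have Pc j : n' <= j <= m' -> P * c j = c j * Theta P /\ P * star (c j) = star (c j) * Theta P.
  move=> jnm {eP}; move: P lP; apply: local_ind.
  - by rewrite rmorph1 !mulr1 !mul1r.
  - move=> z a b [a1 a2] [b1 b2]; rewrite linearP /= !mulrDl !mulrDr.
    by rewrite -!scalerAl -!scalerAr a1 a2 b1 b2.
  - by move=> a b [a1 a2] [b1 b2]; rewrite rmorphM -!mulrA b1 b2 !mulrA a1 a2.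
  - move=> i inm; rewrite Theta_c Theta_sc.
    have ij : (i == j) = false by apply/negP => /eqP; lia.
    split; split; rewrite ?mulrN.
    + by rewrite carC.
    + by rewrite carS ij sub0r opprK.
    + by rewrite carS eq_sym ij sub0r.
    + by rewrite carSS.
move: Q lQ; apply: local_ind.
- by rewrite mulr1 mul1r.
- by move=> z a b aE bE; rewrite mulrDl mulrDr -scalerAr aE bE scalerAl.
- by move=> a b aE bE; rewrite mulrA aE -mulrA bE mulrA.
- by move=> j /Pc; rewrite eP.
Qed.

Context (tau : int -> {lrmorphism A -> A}).
Context (trans : is_translation c tau).

Lemma tau_c k j : tau k (c j) = c (j + k). Proof. by have [_ ->] := trans k. Qed.
Lemma tau_star k (a : A) : tau k (star a) = star (tau k a).
Proof. by have [[_ ->]] := trans k. Qed.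

Lemma tau_loc k n m Q : loc n m Q -> loc (n + k) (m + k) (tau k Q).
Proof.
move: Q; apply: local_ind.
- by rewrite rmorph1; exact: loc1.
- by move=> z P Q lP lQ; rewrite linearP; exact: loc_lin.
- by move=> P Q lP lQ; rewrite rmorphM; exact: locM.
- move=> j jnm; rewrite tau_star tau_c.
  by split; [apply: loc_c | apply: loc_sc]; lia.
Qed.

Lemma Theta_tau k n m Q : loc n m Q -> Theta (tau k Q) = tau k (Theta Q).
Proof.
move: Q; apply: local_ind.
- by rewrite !rmorph1.
- by move=> z P Q lP lQ; rewrite !linearP /= lP lQ.
- by move=> P Q lP lQ; rewrite !rmorphM /= lP lQ.
- move=> j jnm; rewrite Theta_c Theta_sc !linearN /= tau_star tau_c.
  by rewrite Theta_c Theta_sc.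
Qed.

(* Automorphisms of a C*-algebra are isometric, but this weaker bound is
   immediate from |c_j| <= 1 and suffices. *)
Lemma tau_bounded n m Q : loc n m Q ->
  exists2 C, 0 <= C & forall k, rnorm (tau k Q) <= C.
Proof.
move: Q; apply: local_ind.
- by exists 1 => // k; rewrite rmorph1 rnorm1.
- move=> z P Q [B B0 PB] [C C0 QC]; exists (complex.Re `|z| * B + C).
    by rewrite addr_ge0 ?mulr_ge0 // -ler0c RRe_real // ger0_real.
  move=> k; rewrite linearP /= (le_trans (rnormD _ _)) // lerD // rnormZ.
  by rewrite ler_wpM2l // -ler0c RRe_real // ger0_real.
- move=> P Q [B B0 PB] [C C0 QC]; exists (B * C); first by rewrite mulr_ge0.
  by move=> k; rewrite rmorphM (le_trans (rnormM _ _)) // ler_pM ?rnorm_ge0 ?PB ?QC.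
- move=> j _; split; exists 1 => // k; rewrite ?tau_star ?rnorm_star tau_c.
    exact: rnorm_c.
  exact: rnorm_c.
Qed.

End LocalAlgebra.

Lemma conj_it (R : realType) (t : R) :
  (('i * t%:C%C : R[i])^*)%R = 'i * (- t)%:C%C.
Proof.
transitivity (('i : R[i])^* * (t%:C%C : R[i])^* )%R; first exact: rmorphM.
have -> : ((t%:C%C : R[i])^*)%R = t%:C%C by apply: conj_Creal; rewrite complex_real.
have -> : (- t)%:C%C = - t%:C%C :> R[i] by apply: rmorphN.
by rewrite conjCi mulNr mulrN.
Qed.

(** * Evolution in finite volume *)

Section Evolution.
Context (R : realType) (A : cstarAlgType R).
Implicit Types (H P Q : A) (s t : R).

Definition evo H t Q : A :=
  cstar_exp (('i * t%:C%C) *: H) * Q * cstar_exp (('i * (- t)%:C%C) *: H).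

Lemma iscale_opp H t : ('i * (- t)%:C%C) *: H = - (('i * t%:C%C) *: H).
Proof. by rewrite rmorphN /= mulrN scaleNr. Qed.

Lemma normc_it t : complex.Re `|'i * t%:C%C : R[i]| = `|t|.
Proof. by rewrite normrM normCi mul1r normc_def /= expr0n /= addr0 sqrtr_sqr. Qed.

Lemma evo0 H Q : evo H 0 Q = Q.
Proof. by rewrite /evo oppr0 mulr0 scale0r cstar_exp0 mul1r mulr1. Qed.

Lemma evo1 H t : evo H t 1 = 1.
Proof. by rewrite /evo mulr1 iscale_opp cstar_expN. Qed.

Lemma evoB H t P Q : evo H t (P - Q) = evo H t P - evo H t Q.
Proof. by rewrite /evo mulrBr mulrBl. Qed.

Lemma evoM H t P Q : evo H t (P * Q) = evo H t P * evo H t Q.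
Proof.
rewrite /evo !mulrA -(mulrA _ (cstar_exp (('i * (- t)%:C%C) *: H))).
by rewrite iscale_opp cstar_expNr mulr1.
Qed.

Lemma cstar_exp_itD H s t : cstar_exp (('i * (s + t)%:C%C) *: H) =
  cstar_exp (('i * s%:C%C) *: H) * cstar_exp (('i * t%:C%C) *: H).
Proof.
rewrite rmorphD /= mulrDr scalerDl cstar_expD //.
by rewrite -!scalerAl -!scalerAr !scalerA mulrC.
Qed.

Lemma evoD H s t Q : evo H (s + t) Q = evo H s (evo H t Q).
Proof. by rewrite /evo opprD (addrC (- s)) !cstar_exp_itD !mulrA. Qed.

Lemma evoK H t Q : evo H t (evo H (- t) Q) = Q.
Proof. by rewrite -evoD subrr evo0. Qed.

Lemma star_exp_it H t : star H = H ->
  star (cstar_exp (('i * t%:C%C) *: H)) = cstar_exp (('i * (- t)%:C%C) *: H).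
Proof.
by move=> sH; rewrite star_cstar_exp starZ sH conj_it.
Qed.

Lemma rnorm_exp_it H t : star H = H -> rnorm (cstar_exp (('i * t%:C%C) *: H)) = 1.
Proof.
by move=> sH; apply: rnorm_unitary; rewrite star_exp_it // iscale_opp cstar_expNr.
Qed.

Lemma rnorm_evo H t Q : star H = H -> rnorm (evo H t Q) <= rnorm Q.
Proof. by move=> sH; apply: rnorm_unit_conj; rewrite rnorm_exp_it. Qed.

Lemma iter_commutatorZ (z : R[i]) H Q m :
  iter m (commutator (z *: H)) Q = z ^+ m *: iter m (commutator H) Q.
Proof.
elim: m => [|m IH]; first by rewrite expr0 scale1r.
rewrite /= IH /commutator -!scalerAl -!scalerAr !scalerA.
by rewrite (mulrC (z ^+ m)) -scalerBr -exprS.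
Qed.

(** Conjugation by e^x is the exponential of the commutator with x; this is [exp_conv_ad] summed
    over all degrees. *)
Lemma evo_series H t Q : seq_to (series (fun m =>
  ((m`!%:R : R[i])^-1 * ('i * t%:C%C) ^+ m) *: iter m (commutator H) Q))
  (evo H t Q).
Proof.
rewrite /evo iscale_opp; apply: seq_to_ext (exp_conv_to _ _ _) => n.
apply: eq_bigr => m _; by rewrite exp_conv_ad -[RHS]scalerA -iter_commutatorZ.
Qed.

Lemma rnorm_commutator P Q : rnorm (commutator P Q) <= 2 * rnorm P * rnorm Q.
Proof.
rewrite (le_trans (rnormB _ _)) // -mulrA mulr_natl mulr2n lerD ?rnormM //.
by rewrite mulrC rnormM.
Qed.

Lemma commutator_suml (I : Type) (r : seq I) (p : pred I) (F : I -> A) Q :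
  commutator (\sum_(i <- r | p i) F i) Q = \sum_(i <- r | p i) commutator (F i) Q.
Proof. by rewrite /commutator mulr_suml mulr_sumr -sumrB. Qed.

End Evolution.

(** Used with x = 2: the factor 4^{-m} from a short time beats the growth 2^{j+m} of binomial
    coefficients and leaves a geometric series of ratio 1/2. *)
Lemma geometric_quarter (K : fieldType) (x B : K) j m : x != 0 ->
  (x * x)^-1 ^+ m * x ^+ (j + m) * B = x ^+ j * B * x^-1 ^+ m.
Proof.
move=> x0; rewrite !exprVn exprMn exprD.
have := expf_neq0 m x0; move: (x ^+ m) (x ^+ j) => a b a0.
by field.
Qed.

Lemma leq_bin_exp2 n m : ('C(n, m) <= 2 ^ n)%N.
Proof.
elim: n m => [|n IH] [|m] //; first by rewrite bin0 expn_gt0.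
by rewrite binS expnS mul2n -addnn leq_add.
Qed.

Definition near_pt (w : nat) (x k : int) := (x - w%:Z <= k) && (k <= x + w%:Z).

Lemma size_near (w : nat) (x : int) (s : seq int) : uniq s ->
  (size (seq.filter (near_pt w x) s) <= w.*2.+1)%N.
Proof.
move=> us; rewrite -[w.*2.+1](size_iota 0) -(size_map (fun i => x - w%:Z + i%:Z)).
apply: uniq_leq_size; first exact: filter_uniq.
move=> k; rewrite mem_filter => /andP[/andP[k1 k2] _].
apply/mapP; exists (absz (k - (x - w%:Z))%R); last by lia.
by rewrite mem_iota; lia.
Qed.

(** * Quasi-locality of the evolution, uniform in the volume *)

Section QuasiLocality.
Context (R : realType) (A : cstarAlgType R) (c : int -> A)
  (car : car_relations c) (Theta : {lrmorphism A -> A})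
  (parity : is_parity c Theta) (tau : int -> {lrmorphism A -> A})
  (trans : is_translation c tau) (r : nat) (h : A)
  (int_h : local_interaction c Theta r h).
Implicit Types (P Q : A) (x k : int) (s : seq int) (j m L : nat) (z : R[i]).
Local Notation loc := (local_subalg c).

Definition ham s : A := \sum_(k <- s) tau k h.

Lemma h_local k : loc (k - r%:Z) (k + r%:Z) (tau k h).
Proof. case: int_h => _ _ _ lh; have := tau_loc trans (k := k) lh.
by rewrite addrC (addrC _ k).
Qed.

Lemma h_even k : Theta (tau k h) = tau k h.
Proof. by case: int_h => _ _ eh lh; rewrite (Theta_tau parity trans k lh) eh. Qed.

Lemma star_ham s : star (ham s) = ham s.
Proof.
case: int_h => _ sh _ _; rewrite /ham star_sum; apply: eq_bigr => k _.
by rewrite -(tau_star trans) sh.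
Qed.

(** A term [tau k h] has width 2r, so one commutator with the Hamiltonian enlarges a support by at
    most 2r on each side; j counts commutators. *)
Definition radius j : nat := (2 * r * j)%N.

(** The scalar [z] records the parity, 1 for even and -1 for odd elements; commutators with the even
    terms of the Hamiltonian preserve it. *)
Definition centered x j z Q :=
  loc (x - (radius j)%:Z) (x + (radius j)%:Z) Q /\ Theta Q = z *: Q.

(** Terms beyond this window commute with every element supported within [radius L] of [x], so on
    such elements both volumes give the same commutator. *)
Definition agree L x s s' :=
  forall k, near_pt (radius L + r) x k -> (k \in s) = (k \in s').

Lemma centered_mono x j j' z Q : (j <= j')%N -> centered x j z Q ->
  centered x j' z Q.
Proof.
move=> jj [lQ eQ]; split=> //.
have : (radius j <= radius j')%N by rewrite leq_mul2l jj orbT.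
move=> rj; apply: loc_mono lQ; lia.
Qed.

Lemma agree_mono x L L' s s' : (L <= L')%N -> agree L' x s s' -> agree L x s s'.
Proof.
move=> LL ss k /andP[k1 k2]; apply: ss.
have : (radius L <= radius L')%N by rewrite leq_mul2l LL orbT.
by move=> rj; apply/andP; split; lia.
Qed.

Lemma commutator_ham s x j z Q : centered x j z Q -> commutator (ham s) Q =
  \sum_(k <- seq.filter (near_pt (radius j + r) x) s) commutator (tau k h) Q.
Proof.
move=> [lQ _]; rewrite big_filter /ham commutator_suml.
rewrite [RHS]big_mkcond; apply: eq_bigr => k _; case: ifPn => // far.
rewrite /commutator (even_local_comm car parity (@h_local k) (h_even k) lQ) ?subrr //.
by rewrite /near_pt in far; lia.
Qed.

Lemma centered_commutator s x j z Q : centered x j z Q ->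
  centered x j.+1 z (commutator (ham s) Q).
Proof.
move=> cQ; rewrite (commutator_ham s cQ); have [lQ eQ] := cQ.
have rS : radius j.+1 = (radius j + 2 * r)%N by rewrite /radius mulnS addnC.
split.
  apply: loc_sum => k; rewrite mem_filter => /andP[/andP[k1 k2] _].
  have lk : loc (x - (radius j.+1)%:Z) (x + (radius j.+1)%:Z) (tau k h).
    by apply: loc_mono (@h_local k); lia.
  have lQ' : loc (x - (radius j.+1)%:Z) (x + (radius j.+1)%:Z) Q.
    by apply: loc_mono lQ; lia.
  by apply: locB; exact: locM.
rewrite raddf_sum scaler_sumr; apply: eq_bigr => k _.
rewrite /commutator raddfB /= !rmorphM /= eQ h_even.
by rewrite -scalerAl -scalerAr -scalerBr.
Qed.

Lemma centered_iter s x j z Q m : centered x j z Q ->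
  centered x (j + m) z (iter m (commutator (ham s)) Q).
Proof.
move=> cQ; elim: m => [|m IH]; first by rewrite addn0.
by rewrite addnS; exact: centered_commutator.
Qed.

Lemma iter_commutator_agree s s' x j z Q m : uniq s -> uniq s' ->
  centered x j z Q -> agree (j + m) x s s' ->
  iter m (commutator (ham s)) Q = iter m (commutator (ham s')) Q.
Proof.
move=> us us' cQ; elim: m => [|m IH] //= ss.
rewrite -IH; last by apply: agree_mono ss; rewrite addnS.
have cm := centered_iter s m cQ; rewrite !(commutator_ham _ cm).
apply: perm_big; apply: uniq_perm; rewrite ?filter_uniq // => k.
rewrite !mem_filter; case: (boolP (near_pt _ _ _)) => //= kn.
have : agree (j + m) x s s' by apply: agree_mono ss; rewrite addnS.
exact.
Qed.

Lemma h_bound : exists2 C, 0 <= C & forall k, rnorm (tau k h) <= C.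
Proof. by case: int_h => _ _ _; exact: tau_bounded. Qed.

Lemma commutator_bound : exists2 D, 0 < D & forall s x j z Q, uniq s ->
  centered x j z Q -> rnorm (commutator (ham s) Q) <= D * j.+1%:R * rnorm Q.
Proof.
have [C C0 hC] := h_bound.
(* At most 2(2rj + r) + 1 <= (4r + 1)(j + 1) terms touch the support, each contributing at most 2 C
   |Q|; the last 1 only makes the constant positive. *)
exists (2 * C * (4 * r + 1)%:R + 1).
  by rewrite ltr_wpDl // !mulr_ge0.
move=> s x j z Q us cQ; rewrite (commutator_ham s cQ).
have rQ0 := rnorm_ge0 Q.
rewrite (le_trans (rnorm_sum _ _ _)) //.
rewrite (@le_trans _ _ (\sum_(k <- seq.filter (near_pt (radius j + r) x) s)
  2 * C * rnorm Q)) //.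
  apply: ler_sum => k _; rewrite (le_trans (rnorm_commutator _ _)) //.
  by rewrite ler_wpM2r // ler_wpM2l.
rewrite big_const_seq count_predT iter_addr_0 -[_ *+ size _]mulr_natr mulrAC ler_wpM2r //.
rewrite (@le_trans _ _ (2 * C * (4 * r + 1)%:R * j.+1%:R)) //; last first.
  by rewrite ler_wpM2r // lerDl.
rewrite -mulrA -natrM ler_wpM2l ?mulr_ge0 // ler_nat.
rewrite (leq_trans (size_near _ _ us)) // /radius; nia.
Qed.

(* The combinatorial growth of iterated commutators is m! 2^(j+m), so the
   radius of convergence of the series of e^{itH} Q e^{-itH} depends neither on
   the volume s nor on the support of Q. *)
Lemma iter_commutator_bound : exists2 D, 0 < D & forall s x j z Q m, uniq s ->
  centered x j z Q ->
  rnorm (iter m (commutator (ham s)) Q) <= D ^+ m * ((j + m) ^_ m)%:R * rnorm Q.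
Proof.
have [D D0 DP] := commutator_bound; exists D => // s x j z Q m us cQ.
elim: m => [|m IH]; first by rewrite expr0 ffactn0 !mul1r.
rewrite /= (le_trans (DP _ _ _ _ _ us (centered_iter s m cQ))) //.
rewrite addnS ffactSS natrM exprS.
rewrite [leRHS](_ : _ = D * (j + m).+1%:R * (D ^+ m * ((j + m) ^_ m)%:R * rnorm Q)).
  by rewrite ler_wpM2l // mulr_ge0 // ltW.
by ring.
Qed.

(** [L] depends only on [T], [j], [B] and [e], not on the centre or the volume. One [P] serves two
    volumes: different ones give the Cauchy property in the volume, equal ones the approximation by
    a local element of the same parity. *)
Definition quasi_local T := forall j (B e : R), 0 < e -> exists L, forall s s' x z Q t,
  uniq s -> uniq s' -> agree L x s s' -> `|t| <= T -> centered x j z Q ->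
  rnorm Q <= B -> exists P, [/\ centered x L z P,
    rnorm (evo (ham s) t Q - P) <= e & rnorm (evo (ham s') t Q - P) <= e].

Lemma half_exp_small (B e : R) : 0 < e -> exists p, B * 2^-1 ^+ p <= e.
Proof.
move=> e0; have [B0|B0] := leP B 0.
  exists 0%N; rewrite expr0 mulr1 (le_trans B0) // ltW //.
exists (Num.truncn (B / e)).+1; set p := (Num.truncn _).+1.
rewrite exprVn ler_pdivrMr ?exprn_gt0 // -ler_pdivrMl // mulrC.
have : B / e < p%:R by rewrite /p truncnS_gt.
move=> /ltW /le_trans; apply; rewrite -natrX ler_nat ltnW //.
exact: ltn_expl.
Qed.

Lemma quasi_local_small : exists2 T, 0 < T & quasi_local T.
Proof.
have [D D0 DP] := iter_commutator_bound.
(* With |t| D <= 1/4 the m-th term has norm at most (|t| D)^m 'C(j + m, m) |Q| <= 4^{-m} 2^{j+m}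
   B. *)
exists (2 * 2 * D)^-1; first by rewrite invr_gt0 mulr_gt0.
(* [p] is the order of truncation: [geometric_tail] bounds the remainder by 2 (2^j B) 2^{-p}. *)
move=> j B e e0; have [p pe] := half_exp_small (2 * (2 ^+ j * B)) e0.
exists (j + p)%N => s s' x z Q t us us' ss tT cQ QB.
pose u s m : A := ((m`!%:R : R[i])^-1 * ('i * t%:C%C) ^+ m) *:
  iter m (commutator (ham s)) Q.
have tD : `|t| * D <= (2 * 2)^-1.
  by rewrite -ler_pdivlMr // (le_trans tT) // invfM.
have approx s1 : uniq s1 -> rnorm (evo (ham s1) t Q - series (u s1) p) <= e.
  move=> us1; rewrite (le_trans _ pe) //.
  apply: geometric_tail; first exact: evo_series.
  move=> m _; rewrite /u rnormZ.
  have -> : complex.Re `|(m`!%:R : R[i])^-1 * ('i * t%:C%C) ^+ m| =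
      m`!%:R^-1 * `|t| ^+ m.
    apply: (@complexI R); rewrite RRe_real ?ger0_real // normrM normrX rmorphM.
    rewrite rmorphXn /= -normc_it RRe_real ?ger0_real // -normc_invn.
    by rewrite RRe_real ?ger0_real.
  have pos : 0 <= m`!%:R^-1 * `|t| ^+ m by rewrite mulr_ge0 ?invr_ge0 ?exprn_ge0.
  rewrite (le_trans (ler_wpM2l pos (DP _ _ _ _ _ m us1 cQ))) //.
  rewrite -bin_ffact natrM.
  have m0 : m`!%:R != 0 :> R by rewrite pnatr_eq0 -lt0n fact_gt0.
  rewrite (_ : _ * _ = (`|t| * D) ^+ m * 'C(j + m, m)%:R * rnorm Q); last first.
    by rewrite exprMn; field.
  rewrite (@le_trans _ _ ((2 * 2)^-1 ^+ m * (2 ^ (j + m))%:R * B)) //.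
    have tD0 : 0 <= `|t| * D by rewrite mulr_ge0 // ltW.
    rewrite ler_pM ?rnorm_ge0 ?mulr_ge0 ?exprn_ge0 //.
    rewrite ler_pM ?exprn_ge0 ?ler_nat ?leq_bin_exp2 //.
    by rewrite lerXn2r ?nnegrE.
  by rewrite natrX geometric_quarter ?pnatr_eq0.
exists (series (u s) p); split; last 2 first.
- exact: approx.
(* Fewer than [p] commutators stay in the window of index j + p, where the volumes agree, so both
   truncations coincide. *)
- rewrite (_ : series (u s) p = series (u s') p) ?approx //.
  apply: eq_big_nat => m /andP[_ mp]; rewrite /u.
  rewrite (iter_commutator_agree us us' cQ) //.
  by apply: agree_mono ss; rewrite leq_add2l ltnW.
have cm m : (m < p)%N -> centered x (j + p) z (u s m).
  move=> mp; have [|lm em] := @centered_mono x (j + m) (j + p) z _ _ (centered_iter s m cQ).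
    by rewrite leq_add2l ltnW.
  by split; [exact: locZ | rewrite /u linearZ /= em !scalerA mulrC].
split.
  by apply: loc_sum => m; rewrite mem_index_iota => /andP[_ /cm[]].
rewrite /series /= raddf_sum scaler_sumr big_nat [RHS]big_nat.
by apply: eq_bigr => m /andP[_ /cm[]].
Qed.

(** The time is cut into equal steps, and the approximant after all but one of them is the
    observable of the remaining one. Since [evo] does not increase norms, the errors add up. *)
Lemma quasi_local_muln T q : quasi_local T -> quasi_local (T *+ q.+1).
Proof.
move=> qT; elim: q => [//|q IH] j B e e0.
have e2 : 0 < e / 2 by rewrite divr_gt0.
(* [B + e / 2] bounds the norm of the first approximant. *)
have [L1 L1P] := IH j B _ e2; have [L2 L2P] := qT L1 (B + e / 2) _ e2.
exists (maxn L1 L2) => s s' x z Q t us us' ss tT cQ QB.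
pose t1 := t / q.+2%:R; have tE : t = t1 + t1 *+ q.+1.
  by rewrite -mulrS -mulr_natr divfK // pnatr_eq0.
have t1T : `|t1| <= T.
  by rewrite normf_div normr_nat ler_pdivrMr // mulr_natr.
have [||P [cP Ps Ps']] := L1P s s' x z Q (t1 *+ q.+1) us us' _ _ cQ QB.
- by apply: agree_mono ss; rewrite leq_maxl.
- by rewrite normrMn lerMn2r t1T orbT.
have [||P' [cP' P's P's']] := L2P s s' x z P t1 us us' _ t1T cP.
- by apply: agree_mono ss; rewrite leq_maxr.
- rewrite -(subKr (evo (ham s) (t1 *+ q.+1) Q) P) (le_trans (rnormB _ _)) //.
  by rewrite lerD // (le_trans (rnorm_evo _ _ (star_ham s))).
exists P'; split; first by apply: centered_mono cP'; rewrite leq_maxr.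
  rewrite tE evoD (le_trans (rnorm_dist _ (evo (ham s) t1 P) _)) //.
  by rewrite [leRHS]splitr lerD // -evoB (le_trans (rnorm_evo _ _ (star_ham s))).
rewrite tE evoD (le_trans (rnorm_dist _ (evo (ham s') t1 P) _)) //.
by rewrite [leRHS]splitr lerD // -evoB (le_trans (rnorm_evo _ _ (star_ham s'))).
Qed.

Lemma quasi_localT T : quasi_local T.
Proof.
have [T0 T00 /(@quasi_local_muln _ (Num.truncn (T / T0))) qT] := quasi_local_small.
move=> j B e /(qT j B)[L LP]; exists L => s s' x z Q t us us' ss tT.
apply: LP => //; rewrite (le_trans tT) // -mulr_natr -ler_pdivrMl // mulrC.
by rewrite ltW // truncnS_gt.
Qed.

End QuasiLocality.

(** * Boundedness of states, null elements and the Fock state *)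

Section States.
Context (R : realType) (A : cstarAlgType R).
Implicit Types (P Q x y z : A) (phi : {scalar A}).

(* Iteration of z |-> (x + z^2)/2, a contraction of the ball of radius 1/2; its
   fixed point gives the square root 1 - z of 1 - x. *)
Fixpoint sqrt_iter x n : A :=
  if n is n'.+1 then 2^-1 *: (x + sqrt_iter x n' * sqrt_iter x n') else 0.

Lemma rnorm_half x : rnorm ((2^-1 : R[i]) *: x) = 2^-1 * rnorm x.
Proof. by rewrite rnormZ normc_invn. Qed.

(** The threshold 3/4 makes the bound reproduce itself: (3/4 + 1/4) / 2 = 1/2. *)
Lemma sqrt_iter_bound x n : rnorm x <= 3 / 4 -> rnorm (sqrt_iter x n) <= 2^-1.
Proof.
move=> x34; elim: n => [|n IH] /=; first by rewrite rnorm0 invr_ge0.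
rewrite rnorm_half -[leRHS]mulr1 ler_wpM2l ?invr_ge0 //.
rewrite (le_trans (rnormD _ _)) // (_ : 1 = 3 / 4 + 2^-1 * 2^-1 :> R); last by field.
rewrite lerD // (le_trans (rnormM _ _)) //.
by rewrite ler_pM ?rnorm_ge0.
Qed.

Lemma sqrt_iter_step x n : rnorm x <= 3 / 4 ->
  rnorm (sqrt_iter x n.+1 - sqrt_iter x n) <= geometric 1 2^-1 n.
Proof.
move=> x34; elim: n => [|n IH].
  rewrite /= subr0 mulr0 addr0 rnorm_half /geometric /= expr0.
  by rewrite mulr1; lra.
rewrite {1}/sqrt_iter -/(sqrt_iter x n.+1).
rewrite [X in _ - X](_ : _ = 2^-1 *: (x + sqrt_iter x n * sqrt_iter x n)) //.
rewrite -scalerBr rnorm_half /geometric /= exprS mul1r.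
rewrite ler_wpM2l ?invr_ge0 // opprD addrACA subrr add0r.
set a := 2^-1 *: _ in IH *; set b := sqrt_iter x n in IH *.
(* Difference of squares without commutativity; as [a] and [b] have norm at most 1/2, half of it is
   at most half of |a - b|. *)
rewrite (_ : a * a - b * b = a * (a - b) + (a - b) * b); last first.
  by rewrite mulrBr mulrBl addrA subrK.
have ab : rnorm (a - b) <= 2^-1 ^+ n by have := IH; rewrite /geometric /= mul1r.
have a2 : rnorm a <= 2^-1 := sqrt_iter_bound n.+1 x34.
have b2 : rnorm b <= 2^-1 := sqrt_iter_bound n x34.
rewrite (le_trans (rnormD _ _)) //.
rewrite (le_trans (lerD (rnormM _ _) (rnormM _ _))) // [X in _ + X]mulrC -mulrDl.
rewrite -[leRHS]mul1r ler_pM ?addr_ge0 ?rnorm_ge0 //.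
by rewrite [leRHS](_ : 1 = 2^-1 + 2^-1) ?lerD //; field.
Qed.

Lemma star_sqrt_iter x n : star x = x -> star (sqrt_iter x n) = sqrt_iter x n.
Proof.
move=> sx; elim: n => [|n IH] /=; first exact: star0.
by rewrite starZ starD starM IH sx fmorphV rmorph_nat.
Qed.

Lemma one_sub_square x : star x = x -> rnorm x <= 3 / 4 ->
  exists2 y, star y = y & 1 - x = y * y.
Proof.
move=> sx x34.
have [z uz0] : exists z, seq_to (series (fun n => sqrt_iter x n.+1 - sqrt_iter x n)) z.
  apply: (@dominated_series _ _ _ (geometric 1 2^-1)).
    by move=> n; exact: sqrt_iter_step.
  by apply: is_cvg_geometric_series; rewrite ger0_norm ?invr_ge0 // invf_lt1 // ltr1n.
have uz : seq_to (sqrt_iter x) z.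
  apply: seq_to_ext uz0 => n; rewrite /series /= telescope_sumr //.
  by rewrite subr0.
have uz1 : seq_to (fun n => sqrt_iter x n.+1) z.
  by move=> e /uz[N NP]; exists N => n Nn; apply: NP; exact: leqW.
have sz : star z = z.
  apply: (seq_to_unique _ uz); apply: seq_to_ext (seq_to_star uz) => n.
  exact: star_sqrt_iter.
(* Along the iteration 2 u_{n+1} - u_n^2 is constantly [x], the sum being written u - (0 - u) to fit
   [seq_toB]. The limit reads x = 2z - z^2, that is 1 - x = (1 - z)^2. *)
have := seq_toB (seq_toB uz1 (seq_toB (seq_to_const 0) uz1)) (seq_toM uz uz).
rewrite sub0r opprK => xE0.
have xE : x = z + z - z * z.
  apply: seq_to_unique xE0; apply: seq_to_ext (seq_to_const x) => n.
  rewrite sub0r opprK /= -scalerDl (_ : (2^-1 + 2^-1 : R[i]) = 1).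
    by rewrite scale1r addrK.
  by rewrite [RHS]splitr mul1r.
exists (1 - z); first by rewrite starB star1 sz.
by rewrite xE mulrBr mulr1 mulrBl mul1r !opprB opprD !addrA [in RHS](addrAC 1).
Qed.

(** Both 1 - x and 1 + x are squares of self-adjoint elements, so [phi] is nonnegative on them; this
    also makes [phi x] real. *)
Lemma state_selfadjoint_le phi x : is_state phi -> star x = x ->
  rnorm x <= 3 / 4 -> `|phi x| <= 1.
Proof.
move=> [pos one].
have le1 y : star y = y -> rnorm y <= 3 / 4 -> phi y <= 1.
  move=> sy y34; have [w sw wE] := one_sub_square sy y34.
  by have := pos w; rewrite sw -wE raddfB /= one subr_ge0.
move=> sx x34; have x1 := le1 x sx x34.
have := le1 (- x); rewrite starN sx rnormN raddfN /= => /(_ erefl x34) x2.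
have xr : phi x \is Num.real.
  by rewrite -[phi x](subKr 1) rpredB ?rpred1 // ger0_real // subr_ge0.
by rewrite real_ler_norml // x1 lerNl x2.
Qed.

Lemma state_selfadjoint_bound phi x : is_state phi -> star x = x ->
  `|phi x| <= (2 * rnorm x)%:C%C.
Proof.
move=> sphi sx; have [x0|x0] := eqVneq (rnorm x) 0.
  by rewrite x0 (rnorm0_eq0 x0) raddf0 normr0 mulr0.
have xp : 0 < rnorm x by rewrite lt_def x0 rnorm_ge0.
have x2 : 0 < 2 * rnorm x by rewrite mulr_gt0.
have [a0 aR] : 0 <= ((2 * rnorm x)^-1)%:C%C :> R[i] /\
    ((((2 * rnorm x)^-1)%:C%C : R[i])^* = ((2 * rnorm x)^-1)%:C%C)%R.
  split; first by rewrite ler0c invr_ge0 ltW.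
  by apply: conj_Creal; rewrite complex_real.
have := @state_selfadjoint_le phi (((2 * rnorm x)^-1)%:C%C *: x) sphi.
rewrite starZ aR sx => /(_ erefl).
rewrite rnormZ ger0_norm //= => H.
have /H : (2 * rnorm x)^-1 * rnorm x <= 3 / 4.
  by rewrite invfM -mulrA mulVf // mulr1; lra.
rewrite linearZ /= normrM ger0_norm // fmorphV mulrC ler_pdivrMr ?mul1r //.
by rewrite ltcR.
Qed.

(** Twice the real and twice the imaginary part of [Q] have norm at most 2 |Q|, and the self-adjoint
    bound doubles this; so 2 |phi Q| <= 8 |Q|. *)
Lemma state_bound phi Q : is_state phi -> `|phi Q| <= (4 * rnorm Q)%:C%C.
Proof.
move=> sphi.
have i1 : star (Q + star Q) = Q + star Q by rewrite starD starK addrC.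
have i2 : star ('i *: (Q - star Q)) = 'i *: (Q - star Q).
  by rewrite starZ conjCi starB starK scaleNr -scalerN opprB.
have b1 := state_selfadjoint_bound sphi i1.
have b2 := state_selfadjoint_bound sphi i2.
have n1 : rnorm (Q + star Q) <= 2 * rnorm Q.
  by rewrite (le_trans (rnormD _ _)) // rnorm_star; lra.
have n2 : rnorm ('i *: (Q - star Q)) <= 2 * rnorm Q.
  rewrite rnormZ normCi /= mul1r (le_trans (rnormB _ _)) // rnorm_star; lra.
have QE : 2 * phi Q = phi (Q + star Q) - 'i * phi ('i *: (Q - star Q)).
  have -> : phi ('i *: (Q - star Q)) = 'i * phi (Q - star Q) by rewrite linearZ.
  rewrite mulrA -expr2 sqrCi mulN1r opprK raddfB raddfD /=.
  by rewrite addrACA subrr addr0 mulr_natl mulr2n.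
have : 2 * `|phi Q| <= 2 * (4 * rnorm Q)%:C%C.
  rewrite -{1}(normr_nat _ 2) -normrM QE (le_trans (ler_normB _ _)) //.
  rewrite normrM normCi mul1r mulr_natl mulr2n lerD // ?(le_trans b1) ?(le_trans b2) //;
  rewrite lecR; lra.
by rewrite ler_pM2l // ltr0n.
Qed.

(** Nonnegativity in [R[i]] includes being real, so the hypotheses amount to n |g| <= K for all
    n. *)
Lemma archimedean_eq0 (g K : R[i]) : (forall n, 0 <= n%:R * g + K) ->
  (forall n, 0 <= - n%:R * g + K) -> g = 0.
Proof.
move=> g1 g2.
have K0 : 0 <= K by have := g1 0%N; rewrite mul0r add0r.
have nK n : n%:R * `|g| <= K.
  have ngr : n%:R * g \is Num.real.
    by rewrite -(addrK K (n%:R * g)) rpredB // ger0_real.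
  rewrite -{1}(normr_nat R[i] n) -normrM real_ler_norml //.
  apply/andP; split.
    by have := g1 n; rewrite -{1}(opprK K) subr_ge0.
  by have := g2 n; rewrite addrC mulNr subr_ge0.
apply/eqP; rewrite -normr_eq0; apply/eqP.
have gE : `|g| = (complex.Re `|g|)%:C%C by rewrite RRe_real ?ger0_real.
have KE : K = (complex.Re K)%:C%C by rewrite RRe_real ?ger0_real.
rewrite gE; congr (_%:C%C); apply/eqP; rewrite eq_le; apply/andP; split; last first.
  by rewrite -ler0c -gE.
rewrite leNgt; apply/negP => r0.
have := nK (Num.truncn (complex.Re K / complex.Re `|g|)).+1.
rewrite gE KE -(rmorph_nat (real_complex R)) -rmorphM lecR leNgt => /negP; apply.
by rewrite -ltr_pdivrMr // truncnS_gt.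
Qed.

(** The degenerate case of Cauchy-Schwarz. In the positivity of [phi] at z b + P' (P' the adjoint of
    [P]) the term quadratic in z vanishes, so the part of first order in z must vanish too. Real z
    give the sum, imaginary z the difference of the two values. *)
Lemma state_null phi b Q : is_state phi -> phi (star b * b) = 0 ->
  phi (Q * b) = 0 /\ phi (star b * Q) = 0.
Proof.
move=> [pos _] b0.
suff null P : phi (P * b) = 0 /\ phi (star b * star P) = 0.
  by split; [exact: (null Q).1 | have := (null (star Q)).2; rewrite starK].
set w2 := phi (P * b); set w1 := phi (star b * star P).
have f (z : R[i]) : 0 <= (z^*)%R * w1 + z * w2 + phi (P * star P).
  have := pos (z *: b + star P).
  have -> : star (z *: b + star P) * (z *: b + star P) =
      (z^*)%R *: (z *: (star b * b)) + (z^*)%R *: (star b * star P) +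
      z *: (P * b) + P * star P.
    by rewrite starD starZ starK mulrDl !mulrDr -!scalerAl -!scalerAr !addrA.
  rewrite !raddfD /=.
  have pZ (w : R[i]) y : phi (w *: y) = w * phi y by rewrite linearZ.
  by rewrite !pZ b0 !mulr0 add0r.
have sum0 : w1 + w2 = 0.
  apply: (@archimedean_eq0 _ (phi (P * star P))) => n.
    by have := f n%:R; rewrite rmorph_nat -mulrDr.
  by have := f (- n%:R); rewrite rmorphN rmorph_nat -mulrDr.
have ci n : ((n%:R * 'i : R[i])^*)%R = - (n%:R * 'i).
  transitivity ((n%:R : R[i])^* * ('i : R[i])^*)%R; first exact: rmorphM.
  by rewrite rmorph_nat conjCi mulrN.
have dif0 : 'i * (w2 - w1) = 0.
  apply: (@archimedean_eq0 _ (phi (P * star P))) => n.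
    have := f (n%:R * 'i); rewrite ci.
    by rewrite (_ : n%:R * ('i * (w2 - w1)) = - (n%:R * 'i) * w1 + n%:R * 'i * w2);
      last ring.
  have := f (- (n%:R * 'i)); rewrite (_ : ((- _)^*)%R = n%:R * 'i); last first.
    by rewrite -[RHS]opprK -[in RHS]ci; exact: rmorphN.
  by rewrite (_ : - n%:R * ('i * (w2 - w1)) = n%:R * 'i * w1 + - (n%:R * 'i) * w2);
    last ring.
move/eqP: dif0; rewrite mulf_eq0 (negbTE (neq0Ci _)) subr_eq0 => /eqP w21.
move/eqP: sum0; rewrite w21 -mulr2n mulrn_eq0 /= => /eqP w10.
by rewrite w10.
Qed.

(** By [state_null] each site factor acts as -1 from either side, and the two signs (-1)^len
    cancel. *)
Lemma fock_string (c : int -> A) (phi : {scalar A}) a len Q : is_fock c phi ->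
  phi (parity_string c a len * Q * parity_string c a len) = phi Q.
Proof.
move=> [sphi fock].
have site j P : phi (P * site_parity c j) = - phi P /\
    phi (site_parity c j * P) = - phi P.
  rewrite /site_parity mulrBr mulrBl mul1r mulr1 -scalerAl -scalerAr.
  rewrite !raddfB /= !linearZ /= mulrA (state_null _ sphi (fock j)).1.
  by rewrite -(mulrA (star _)) (state_null _ sphi (fock j)).2 mulr0 sub0r.
have right P : phi (P * parity_string c a len) = (-1) ^+ len * phi P.
  elim: len => [|len IH]; first by rewrite parity_string0 mulr1 mul1r.
  by rewrite parity_stringS mulrA (site _ _).1 IH exprS mulN1r mulNr.
have left P : phi (parity_string c a len * P) = (-1) ^+ len * phi P.
  elim: len P {right} => [|len IH] P; first by rewrite parity_string0 !mul1r.
  by rewrite parity_stringS -mulrA IH (site _ _).2 exprS mulrN mulN1r mulNr.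
by rewrite right left mulrA -exprD addnn -signr_odd odd_double mul1r.
Qed.

End States.

(** * Duhamel's estimate by subdivision of time *)

Section Duhamel.
Context (R : realType) (A : cstarAlgType R).
Implicit Types (H P Q X : A) (s t e d : R).

Lemma exp_order2 X : rnorm X <= 2^-1 ->
  rnorm (cstar_exp X - (1 + X)) <= 2 * rnorm X ^+ 2.
Proof.
move=> X2.
have -> : 1 + X = series (exp_term X) 2.
  rewrite /series /= big_nat_recr // big_nat1 /exp_term /= !invr1.
  by rewrite !scale1r expr0 expr1.
(* [geometric_tail] at p = 2 with B = 4 |X|^2: for m >= 2, |X|^m <= |X|^2 2^{-(m-2)} = 4 |X|^2
   2^{-m}. *)
rewrite (_ : 2 * _ = 2 * (4 * rnorm X ^+ 2) * 2^-1 ^+ 2); last by field.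
apply: geometric_tail; first exact: cstar_exp_to.
move=> m m2; rewrite (le_trans (rnorm_exp_term _ _)) // /exp_coeff /=.
rewrite (@le_trans _ _ (rnorm X ^+ m)) //.
  rewrite ler_pdivrMr ?ltr0n ?fact_gt0 //.
  by rewrite ler_peMr ?exprn_ge0 ?rnorm_ge0 // ler1n fact_gt0.
move: (m - 2)%N (subnKC m2) => k <-; rewrite !(exprD _ 2 k).
rewrite (_ : 4 * _ * _ = rnorm X ^+ 2 * 2^-1 ^+ k).
  rewrite ler_wpM2l ?sqr_ge0 //.
  by rewrite lerXn2r ?nnegrE ?rnorm_ge0 ?invr_ge0.
by move: (2^-1 ^+ k) (rnorm X) => a b; field.
Qed.

(** The propagator of the interaction picture: evolving under [H'] is conjugating by it and then
    evolving under [H]. *)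
Definition cocycle H H' t : A :=
  cstar_exp (('i * (- t)%:C%C) *: H) * cstar_exp (('i * t%:C%C) *: H').

Lemma cocycle_inv H H' t : cocycle H H' t * cocycle H' H t = 1.
Proof.
rewrite /cocycle -!mulrA (mulrA (cstar_exp (('i * t%:C%C) *: H'))).
by rewrite (iscale_opp H') cstar_expN mul1r iscale_opp cstar_expNr.
Qed.

Lemma rnorm_cocycle H H' t : star H = H -> star H' = H' ->
  rnorm (cocycle H H' t) <= 1.
Proof.
by move=> sH sH'; rewrite (le_trans (rnormM _ _)) // !rnorm_exp_it // mulr1.
Qed.

Lemma cocycleD H H' s t : cocycle H H' (s + t) =
  evo H (- s) (cocycle H H' t) * cocycle H H' s.
Proof.
rewrite /cocycle /evo opprK opprD (cstar_exp_itD H) (addrC s t) cstar_exp_itD.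
rewrite -!mulrA [in RHS](mulrA (cstar_exp (('i * s%:C%C) *: H))).
by rewrite (iscale_opp H s) cstar_expN mul1r.
Qed.

(** [C] depends on the norms of [H] and [H'], hence on the volume. This is harmless: in [duhamel] it
    only decides how fine the subdivision is and drops out of the bound. *)
Lemma cocycle_order2 H H' : star H = H -> star H' = H' ->
  exists C, forall d, `|d| * (rnorm H + rnorm H') <= 2^-1 ->
  rnorm (cocycle H H' d - (1 + ('i * d%:C%C) *: (H' - H))) <= C * d ^+ 2.
Proof.
(* The 3 covers 2 |x|^2 + 3 |y|^2 + |y| |x|, where 3 |y|^2 is 2 |y|^2 times the bound 3/2 for the
   norm of 1 + x. *)
move=> sH sH'; exists (3 * (rnorm H + rnorm H') ^+ 2) => d dK.
set y := ('i * (- d)%:C%C) *: H; set x := ('i * d%:C%C) *: H'.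
have xE : rnorm x = `|d| * rnorm H' by rewrite rnormZ normc_it.
have yE : rnorm y = `|d| * rnorm H by rewrite rnormZ normc_it normrN.
have [x0 y0] := (rnorm_ge0 x, rnorm_ge0 y).
have xy : rnorm x + rnorm y <= 2^-1 by rewrite xE yE -mulrDr addrC.
have -> : 1 + ('i * d%:C%C) *: (H' - H) = 1 + (x + y).
  by rewrite scalerBr /y iscale_opp.
have -> : cocycle H H' d - (1 + (x + y)) =
    cstar_exp y * (cstar_exp x - (1 + x)) + (cstar_exp y - (1 + y)) * (1 + x) + y * x.
  rewrite /cocycle -/x -/y mulrBr mulrBl [in RHS]addrA subrK -addrA; congr (_ + _).
  by rewrite mulrDl mul1r mulrDr mulr1 !addrA [in RHS]opprD subrK.
have ex := exp_order2 (le_trans (_ : rnorm x <= rnorm x + rnorm y) xy).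
have ey := exp_order2 (le_trans (_ : rnorm y <= rnorm x + rnorm y) xy).
have {}ex := ex ltac:(by rewrite lerDl); have {}ey := ey ltac:(by rewrite lerDr).
have b1 : rnorm (cstar_exp y * (cstar_exp x - (1 + x))) <= 2 * rnorm x ^+ 2.
  by rewrite (le_trans (rnormM _ _)) // rnorm_exp_it // mul1r.
have b2 : rnorm ((cstar_exp y - (1 + y)) * (1 + x)) <= 3 * rnorm y ^+ 2.
  rewrite (le_trans (rnormM _ _)) //.
  rewrite (@le_trans _ _ (2 * rnorm y ^+ 2 * (3 / 2))) //; last by lra.
  rewrite ler_pM ?rnorm_ge0 // (le_trans (rnormD _ _)) // rnorm1; lra.
have b3 := rnormM y x.
rewrite (le_trans (rnormD _ _)) // (le_trans (lerD (rnormD _ _) (lexx _))) //.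
rewrite (le_trans (lerD (lerD b1 b2) b3)) //.
rewrite (_ : 3 * _ * _ = 3 * (rnorm x + rnorm y) ^+ 2); last first.
  by rewrite xE yE -mulrDr exprMn -normrX [`|_ ^+ 2|]ger0_norm ?sqr_ge0 //; ring.
move: (rnorm x) (rnorm y) x0 y0 => a b a0 b0; nra.
Qed.

Lemma commutatorM P Q X : commutator (P * Q) X = P * commutator Q X + commutator P X * Q.
Proof. by rewrite /commutator mulrBr mulrBl !mulrA addrA subrK. Qed.

Lemma commutator_cocycle_step H H' X C d e : star H = H -> star H' = H' ->
  rnorm X <= 1 ->
  rnorm (cocycle H H' d - (1 + ('i * d%:C%C) *: (H' - H))) <= C * d ^+ 2 ->
  forall t, rnorm (commutator (evo H (- t) (H' - H)) X) <= e ->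
  rnorm (commutator (evo H (- t) (cocycle H H' d)) X) <=
  `|d| * e + 2 * (C * d ^+ 2).
Proof.
move=> sH sH' X1; set rho := _ - _ => rC t tX.
have -> : cocycle H H' d = 1 + ('i * d%:C%C) *: (H' - H) + rho.
  by rewrite /rho addrC subrK.
have -> : commutator (evo H (- t) (1 + ('i * d%:C%C) *: (H' - H) + rho)) X =
    ('i * d%:C%C) *: commutator (evo H (- t) (H' - H)) X +
    commutator (evo H (- t) rho) X.
  have -> : evo H (- t) (1 + ('i * d%:C%C) *: (H' - H) + rho) =
      1 + (('i * d%:C%C) *: evo H (- t) (H' - H) + evo H (- t) rho).
    transitivity (evo H (- t) 1 + ('i * d%:C%C) *: evo H (- t) (H' - H) +
      evo H (- t) rho); last by rewrite evo1 addrA.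
    by move: (H' - H) => D; rewrite /evo !mulrDr !mulrDl -scalerAr -scalerAl.
  rewrite /commutator mulrDl mulrDr mul1r mulr1 opprD addrACA subrr add0r.
  by rewrite mulrDl mulrDr -scalerAl -scalerAr opprD addrACA scalerBr.
rewrite (le_trans (rnormD _ _)) // lerD //.
  by rewrite rnormZ normc_it ler_wpM2l.
rewrite (le_trans (rnorm_commutator _ _)) //.
rewrite -[leRHS]mulr1 ler_pM ?mulr_ge0 ?rnorm_ge0 // ler_wpM2l //.
by rewrite (le_trans (rnorm_evo _ _ sH)).
Qed.

Lemma duhamel H H' X t e : star H = H -> star H' = H' -> rnorm X <= 1 ->
  (forall u, `|u| <= `|t| -> rnorm (commutator (evo H u (H' - H)) X) <= e) ->
  rnorm (evo H' t X - evo H t X) <= `|t| * e.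
Proof.
move=> sH sH' X1 small.
(* With W the cocycle and U = e^{itH}, the difference is U (W X W^{-1} - X) U^{-1} = U [W, X] W^{-1}
   U^{-1}, so only [W, X] has to be estimated. *)
rewrite (_ : evo H' t X - evo H t X = cstar_exp (('i * t%:C%C) *: H) *
  (commutator (cocycle H H' t) X * cocycle H' H t) * cstar_exp (('i * (- t)%:C%C) *: H));
  last first.
  rewrite /commutator mulrBl -(mulrA X) cocycle_inv mulr1 mulrBr mulrBl.
  have UV : cstar_exp (('i * t%:C%C) *: H) * cstar_exp (('i * (- t)%:C%C) *: H) = 1.
    by rewrite iscale_opp cstar_expN.
  by congr (_ - _); rewrite /cocycle /evo !mulrA UV mul1r -!mulrA UV mulr1.
rewrite (le_trans (rnorm_unit_conj _ _ _)) ?rnorm_exp_it //.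
rewrite (le_trans (rnormM _ _)) // -[leRHS]mulr1 ler_pM ?rnorm_ge0 ?rnorm_cocycle //.
have [C CP] := cocycle_order2 sH sH'.
apply/ler_addgt0Pr => f f0.
(* The first bound makes the accumulated remainder n * 2 C (t/n)^2 at most [f]; the second makes
   each step short enough for [cocycle_order2]. *)
pose n := maxn (Num.truncn (2 * (C * t ^+ 2) / f)).+1
  (Num.truncn (2 * (`|t| * (rnorm H + rnorm H')))).+1.
have n1 : 2 * (C * t ^+ 2) / f <= n%:R.
  by rewrite (le_trans (ltW (truncnS_gt _))) // ler_nat leq_maxl.
have n2 : 2 * (`|t| * (rnorm H + rnorm H')) <= n%:R.
  by rewrite (le_trans (ltW (truncnS_gt _))) // ler_nat leq_maxr.
have n0 : 0 < n%:R :> R by rewrite ltr0n leq_max.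
move: n n1 n2 n0 => n n1 n2 n0; pose d := t / n%:R.
have dn : `|d| = `|t| / n%:R by rewrite normf_div normr_nat.
have dC : rnorm (cocycle H H' d - (1 + ('i * d%:C%C) *: (H' - H))) <= C * d ^+ 2.
  apply: CP; rewrite dn mulrAC ler_pdivrMr //.
  by rewrite -ler_pdivrMl ?invr_gt0 // invrK.
(* The commutator is a derivation and all factors of the cocycle are contractions, so each small
   step adds at most one summand; this replaces the integral. *)
have step k : (k <= n)%N -> rnorm (commutator (cocycle H H' (d *+ k)) X) <=
    (`|d| * e + 2 * (C * d ^+ 2)) *+ k.
  elim: k => [_|k IH kn].
    rewrite !mulr0n /cocycle oppr0 mulr0 !scale0r cstar_exp0 mulr1.
    by rewrite /commutator mul1r mulr1 subrr rnorm0.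
  rewrite [d *+ _]mulrSr [leRHS]mulrSr cocycleD commutatorM.
  apply: (le_trans (rnormD _ _)); apply: lerD.
    apply: (le_trans (rnormM _ _)); rewrite -[leRHS]mul1r.
    apply: ler_pM; rewrite ?rnorm_ge0 //; last exact: IH (ltnW kn).
    by apply: (le_trans (rnorm_evo _ _ sH)); exact: rnorm_cocycle.
  apply: (le_trans (rnormM _ _)); rewrite -[leRHS]mulr1.
  apply: ler_pM; rewrite ?rnorm_ge0 //; last exact: rnorm_cocycle.
  apply: commutator_cocycle_step => //; apply: small.
  rewrite normrN normrMn dn -[_ *+ k]mulr_natr mulrAC ler_pdivrMr //.
  by rewrite ler_wpM2l // ler_nat ltnW.
have := step n (leqnn n).
rewrite (_ : d *+ n = t); last by rewrite -[_ *+ n]mulr_natr divfK // gt_eqF.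
move=> /le_trans; apply; rewrite mulrnDl -[X in X + _]mulr_natr -[X in _ + X]mulr_natr.
apply: lerD; first by rewrite dn mulrAC divfK // gt_eqF.
rewrite /d; rewrite ler_pdivrMr // in n1.
rewrite (_ : 2 * (C * (t / n%:R) ^+ 2) * n%:R = 2 * (C * t ^+ 2) / n%:R).
  by rewrite ler_pdivrMr // [leRHS]mulrC.
by move: (n%:R : R) n0 => a a0; field; rewrite gt_eqF.
Qed.

End Duhamel.

(** * Effect of the flip F on the evolved string correlator *)

Section ParityFlip.
Context (R : realType) (A : cstarAlgType R) (c : int -> A)
  (car : car_relations c) (Theta : {lrmorphism A -> A})
  (parity : is_parity c Theta) (tau : int -> {lrmorphism A -> A})
  (trans : is_translation c tau) (r : nat) (h : A)
  (int_h : local_interaction c Theta r h).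
Implicit Types (P Q : A) (x : int) (s : seq int) (j k L M : nat) (z : R[i])
  (t e : R).
Local Notation loc := (local_subalg c).
Local Notation ham := (ham tau h).
Local Notation centered := (centered c Theta r).
Local Notation string := (parity_string c).

Lemma loc_string a (len : nat) n m : n <= a -> a + len%:Z <= m + 1 ->
  loc n m (string a len).
Proof.
elim: len => [|len IH] na am; first by rewrite parity_string0; exact: loc1.
rewrite parity_stringS; apply: locM; first by apply: IH; lia.
apply: locB; last exact: loc1.
have al : n <= a + len%:Z <= m by lia.
by apply: locZ; apply: locM; [exact: loc_sc | exact: loc_c].
Qed.

Lemma Theta_string a (len : nat) : Theta (string a len) = string a len.
Proof.
elim: len => [|len IH]; first by rewrite parity_string0 rmorph1.
rewrite parity_stringS rmorphM /= IH /site_parity raddfB /= rmorph1 linearZ /= rmorphM.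
by rewrite /= (Theta_c parity) (Theta_sc parity) mulrNN.
Qed.

Lemma loc_centered n m z Q : loc n m Q -> Theta Q = z *: Q ->
  exists j, centered 0 j z Q.
Proof.
move=> lQ eQ; exists (`|n| + `|m|)%N; split=> //.
have r1 : (1 < r)%N by case: int_h.
have : (`|n| + `|m| <= radius r (`|n| + `|m|))%N.
  by rewrite /radius leq_pmull // muln_gt0 /= ltnW.
by move: (radius _ _) => w nw; apply: loc_mono lQ; lia.
Qed.

Lemma centered_tau j z Q k : centered 0 j z Q -> centered k%:Z j z (tau k%:Z Q).
Proof.
move=> [lQ eQ]; split.
  by have := tau_loc trans (k := k%:Z) lQ; apply: loc_mono; lia.
by rewrite (Theta_tau parity trans _ lQ) eQ linearZ.
Qed.

Lemma string_conj_dist a (len : nat) (b P : A) (z : R[i]) e :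
  `|z| = 1 -> rnorm (b - P) <= e ->
  string a len * P * string a len = z *: P ->
  rnorm (z *: b - string a len * b * string a len) <= 2 * e.
Proof.
move=> z1 be SP.
rewrite (_ : _ - _ = z *: (b - P) - string a len * (b - P) * string a len).
  rewrite (le_trans (rnormB _ _)) // mulr_natl mulr2n lerD //.
    by rewrite rnormZ z1 /= mul1r.
  by rewrite (le_trans (rnorm_unit_conj _ _ _)) // rnorm_parity_string.
by rewrite mulrBr mulrBl SP scalerBr opprB addrA subrK.
Qed.

Definition flip k := string (- k%:Z) (k + k)%N.

Lemma rnorm_flip k : rnorm (flip k) = 1. Proof. exact: rnorm_parity_string. Qed.
Lemma flip_sq k : flip k * flip k = 1. Proof. exact: parity_string_sq. Qed.

Lemma flip_odd t j Q e : 0 < e -> centered 0 j (-1) Q ->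
  exists K, forall k s, (K <= k)%N -> uniq s ->
  rnorm (evo (ham s) t Q + flip k * evo (ham s) t Q * flip k) <= e.
Proof.
move=> e0 cQ; have e2 : 0 < e / 2 by rewrite divr_gt0.
have [L LP] := quasi_localT car parity trans int_h `|t| j (rnorm Q) e2.
exists (radius r L).+1 => k s Kk us.
have [//|P [[lP eP] Ps _]] := LP s s 0 (-1) Q t us us (fun=> fun=> erefl) _ cQ (lexx _).
have SP : flip k * P * flip k = (-1) *: P.
  rewrite (parity_string_inside car parity lP); last by lia.
  by rewrite -mulrA flip_sq mulr1 eP.
have := string_conj_dist (normrN1 _) Ps SP.
rewrite scaleN1r -opprD rnormN; move=> /le_trans; apply.
by rewrite mulrC divfK // pnatr_eq0.
Qed.

Lemma flip_far t j z Q e : 0 < e -> centered 0 j z Q ->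
  exists K, forall k s, (K <= k)%N -> uniq s ->
  rnorm (evo (ham s) t (tau (k + k)%N%:Z Q) -
    flip k * evo (ham s) t (tau (k + k)%N%:Z Q) * flip k) <= e.
Proof.
move=> e0 cQ; have e2 : 0 < e / 2 by rewrite divr_gt0.
(* A bound common to all translates keeps [L], and with it the threshold, independent of k. *)
have [C C0 CP] := tau_bounded car trans (cQ.1).
have [L LP] := quasi_localT car parity trans int_h `|t| j C e2.
exists (radius r L).+1 => k s Kk us.
have [//|P [[lP eP] Ps _]] := LP s s (k + k)%N%:Z z _ t us us (fun=> fun=> erefl) _
  (centered_tau (k + k) cQ) (CP _).
have SP : flip k * P * flip k = 1 *: P.
  rewrite (parity_string_outside car lP); last by lia.
  by rewrite -mulrA flip_sq mulr1 scale1r.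
have := string_conj_dist (normr1 _) Ps SP.
rewrite scale1r; move=> /le_trans; apply.
by rewrite mulrC divfK // pnatr_eq0.
Qed.

Definition edge k x := near_pt r (- k%:Z) x || near_pt r k%:Z x.

Lemma size_edge k s : uniq s ->
  (size (seq.filter (edge k) s) <= 2 * r.*2.+1)%N.
Proof.
move=> us; rewrite size_filter.
rewrite -[count (edge k) s]/(count (predU (near_pt r (- k%:Z)) (near_pt r k%:Z)) s).
have := count_predUI (near_pt r (- k%:Z)) (near_pt r k%:Z) s.
have := size_near r (- k%:Z) us; have := size_near r k%:Z us.
by rewrite !size_filter; lia.
Qed.

Definition defect k x := flip k * tau x h * flip k - tau x h.

(** Away from the edges of F a term lies outside, where F commutes with it, or inside, where F acts
    as [Theta] and fixes the even term. *)
Lemma flip_h k x : ~~ edge k x -> defect k x = 0.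
Proof.
move=> ne; have lx := @h_local _ _ _ _ _ trans _ _ int_h x.
have [far|near] := boolP ((x + r%:Z < - k%:Z) || (- k%:Z + (k + k)%N%:Z <= x - r%:Z)).
  rewrite /defect (parity_string_outside car lx) //.
  by rewrite -mulrA flip_sq mulr1 subrr.
rewrite /defect (parity_string_inside car parity lx).
  by rewrite -mulrA flip_sq mulr1 (h_even parity trans int_h) subrr.
move: ne near; rewrite /edge /near_pt; lia.
Qed.

Lemma defect_centered k x : centered x 1 1 (defect k x).
Proof.
have lx := @h_local _ _ _ _ _ trans _ _ int_h x.
split.
  have : loc (x - r%:Z) (x + r%:Z) (defect k x).
    by apply: locB => //; exact: parity_string_conj_loc.
  by apply: loc_mono; rewrite /radius; lia.
rewrite scale1r /defect raddfB /= !rmorphM /= Theta_string.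
by rewrite (h_even parity trans int_h).
Qed.

Lemma flip_ham k s : flip k * ham s * flip k - ham s =
  \sum_(x <- seq.filter (edge k) s) defect k x.
Proof.
rewrite big_filter [RHS]big_mkcond /= mulr_sumr mulr_suml -sumrB.
by apply: eq_bigr => x _; case: ifPn => // /flip_h.
Qed.

Lemma evo_sum H t (I : Type) (p : seq I) (F : I -> A) :
  evo H t (\sum_(i <- p) F i) = \sum_(i <- p) evo H t (F i).
Proof. by rewrite /evo mulr_sumr mulr_suml. Qed.

Lemma flip_evo H k t Q :
  flip k * evo H t Q * flip k = evo (flip k * H * flip k) t (flip k * Q * flip k).
Proof.
have E w : cstar_exp (w *: (flip k * H * flip k)) = flip k * cstar_exp (w *: H) * flip k.
  by rewrite cstar_exp_conj ?flip_sq // -scalerAr -scalerAl.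
rewrite /evo !E; move: (cstar_exp _) (cstar_exp _) => U V.
rewrite !mulrA -(mulrA _ (flip k) (flip k)) flip_sq mulr1.
by rewrite -(mulrA _ (flip k) (flip k)) flip_sq mulr1.
Qed.

Lemma flip_string t e : 0 < e ->
  exists K, forall k s, (K <= k)%N -> uniq s ->
  rnorm (evo (ham s) t (string 0 (k + k)%N) -
    flip k * evo (ham s) t (string 0 (k + k)%N) * flip k) <= e.
Proof.
move=> e0; have [C C0 CP] := h_bound car trans int_h.
(* [N] bounds the number of terms at the two edges, each having a commutator of norm at most 2 d
   with the string; [d] is chosen so that |t| N (2 d) <= e. *)
pose N : R := (2 * r.*2.+1)%N%:R.
have N0 : 0 < N by rewrite ltr0n.
have t0 : 0 < `|t| + 1 by rewrite ltr_wpDl.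
pose d := e / (2 * N * (`|t| + 1)).
have d0 : 0 < d by rewrite divr_gt0 // !mulr_gt0.
have [L LP] := quasi_localT car parity trans int_h `|t| 1 (2 * C) d0.
exists (radius r L + r).+1 => k s Kk us.
have sH := star_ham trans int_h s.
rewrite rnorm_sub_sym flip_evo.
have -> : flip k * string 0 (k + k)%N * flip k = string 0 (k + k)%N.
  by rewrite (parity_stringC car) -mulrA flip_sq mulr1.
have sF : star (flip k * ham s * flip k) = flip k * ham s * flip k.
  by rewrite !starM sH (star_parity_string car) mulrA.
apply: (@le_trans _ _ (`|t| * (N * (2 * d)))).
  apply: duhamel => //; first by rewrite rnorm_parity_string.
  move=> u ut; rewrite flip_ham evo_sum commutator_suml.
  apply: (le_trans (rnorm_sum _ _ _)).
  apply: (@le_trans _ _ (\sum_(x <- seq.filter (edge k) s) 2 * d)).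
    rewrite big_seq [leRHS]big_seq; apply: ler_sum => x.
    rewrite mem_filter => /andP[xk _].
    have Bx : rnorm (defect k x) <= 2 * C.
      apply: (le_trans (rnormB _ _)); rewrite mulr_natl mulr2n lerD //.
      by rewrite (le_trans (rnorm_unit_conj _ _ _)) // rnorm_flip.
    have [P [[lP eP] Ps _]] := LP s s x 1 _ u us us (fun=> fun=> erefl) ut
      (defect_centered k x) Bx.
    (* For a term near -k, [P] lies to the left of the string; near k it lies inside the string and
       is even. It commutes with the string in both cases. *)
    have PS : commutator P (string 0 (k + k)%N) = 0.
      rewrite /commutator; apply/eqP; rewrite subr_eq0; apply/eqP/esym.
      move: xk; rewrite /edge /near_pt => /orP[] /andP[x1 x2].
        by rewrite (parity_string_outside car lP) //; lia.
      by rewrite (parity_string_inside car parity lP) ?eP ?scale1r //; lia.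
    have -> : commutator (evo (ham s) u (defect k x)) (string 0 (k + k)%N) =
        commutator (evo (ham s) u (defect k x) - P) (string 0 (k + k)%N).
      rewrite -[LHS]subr0 -PS /commutator mulrBl mulrBr !opprB.
      by rewrite addrACA [in RHS]addrACA [- _ + _]addrC.
    apply: (le_trans (rnorm_commutator _ _)); rewrite rnorm_parity_string // mulr1.
    by rewrite ler_wpM2l.
  rewrite big_const_seq count_predT iter_addr_0 -[leLHS]mulr_natl.
  by apply: ler_wpM2r; [rewrite mulr_ge0 // ltW | rewrite ler_nat size_edge].
rewrite (_ : N * (2 * d) = e / (`|t| + 1)).
  rewrite mulrCA -[leRHS]mulr1 ler_wpM2l ?(ltW e0) // ler_pdivrMr // mul1r.
  by rewrite lerDl.
rewrite /d; move: (`|t| + 1) t0 N N0 {d d0 LP} => a a0 b b0.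
by field; rewrite !gt_eqF.
Qed.

(** Telescoping over three factors, of which the flip nearly reverses the first and nearly fixes the
    other two, so that every difference or sum on the right is small. *)
Lemma flip_triple k (a b d : A) :
  a * b * d + flip k * (a * b * d) * flip k =
  (a + flip k * a * flip k) * b * d
  - flip k * a * flip k * (b - flip k * b * flip k) * d
  - flip k * a * flip k * (flip k * b * flip k) * (d - flip k * d * flip k).
Proof.
have E u v : flip k * u * flip k * (flip k * v * flip k) = flip k * (u * v) * flip k.
  by rewrite !mulrA -(mulrA _ (flip k) (flip k)) flip_sq mulr1.
rewrite -[flip k * (a * b * d) * flip k]E -[flip k * (a * b) * flip k]E.
move: (flip k * a * flip k) (flip k * b * flip k) (flip k * d * flip k) => a' b' d'.
by rewrite !mulrDl !mulrBr mulrBl !opprD !opprK !addrA addrK addrK.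
Qed.

Lemma flip_correlation t n m Q1 Q2 e : 0 < e ->
  loc n (-1) Q1 -> Theta Q1 = - Q1 -> loc 0 m Q2 -> Theta Q2 = - Q2 ->
  exists K, forall k s, (K <= k)%N -> uniq s ->
  let X := Q1 * string 0 (k + k)%N * tau (k + k)%N%:Z Q2 in
  rnorm (evo (ham s) t X + flip k * evo (ham s) t X * flip k) <= e.
Proof.
move=> e0 l1 o1 l2 o2.
have [|j1 c1] := loc_centered l1 (z := -1); first by rewrite scaleN1r.
have [|j2 c2] := loc_centered l2 (z := -1); first by rewrite scaleN1r.
have [C C0 CP] := tau_bounded car trans l2.
pose B := rnorm Q1 + 1; pose D := C + 1.
have B0 : 0 < B by rewrite ltr_wpDl ?rnorm_ge0.
have D0 : 0 < D by rewrite ltr_wpDl.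
have e3 : 0 < e / 3 by rewrite divr_gt0.
have [|K1 P1] := flip_odd t (e := e / 3 / D) _ c1; first by rewrite divr_gt0.
have [|K2 P2] := flip_string t (e := e / 3 / (B * D)); first by rewrite divr_gt0 ?mulr_gt0.
have [|K3 P3] := flip_far t (e := e / 3 / B) _ c2; first by rewrite divr_gt0.
exists (maxn K1 (maxn K2 K3)) => k s; rewrite !geq_max => /and3P[k1 k2 k3] us /=.
have {}P1 := P1 k s k1 us; have {}P2 := P2 k s k2 us; have {}P3 := P3 k s k3 us.
have sH := star_ham trans int_h s.
rewrite !evoM flip_triple.
have aB : rnorm (evo (ham s) t Q1) <= B.
  by apply: (le_trans (rnorm_evo _ _ sH)); rewrite lerDl.
have b1 : rnorm (evo (ham s) t (string 0 (k + k)%N)) <= 1.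
  by apply: (le_trans (rnorm_evo _ _ sH)); rewrite rnorm_parity_string.
have dD : rnorm (evo (ham s) t (tau (k + k)%N%:Z Q2)) <= D.
  by apply: (le_trans (rnorm_evo _ _ sH)); rewrite (le_trans (CP _)) // lerDl.
have Fle (y : A) : rnorm (flip k * y * flip k) <= rnorm y.
  by apply: rnorm_unit_conj; rewrite rnorm_flip.
have aB' := le_trans (Fle _) aB; have b1' := le_trans (Fle _) b1.
rewrite (_ : e = e / 3 + e / 3 + e / 3); last by field.
apply: (le_trans (rnormB _ _)); apply: lerD.
  apply: (le_trans (rnormB _ _)); apply: lerD.
    apply: (le_trans (rnormM3 _ _ _)).
    rewrite -[leRHS](@divfK _ D) ?gt_eqF //; apply: ler_pM; rewrite ?rnorm_ge0 ?mulr_ge0 ?rnorm_ge0 //.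
    by rewrite -[leRHS]mulr1; apply: ler_pM; rewrite ?rnorm_ge0.
  apply: (le_trans (rnormM3 _ _ _)).
  rewrite (_ : e / 3 = B * (e / 3 / (B * D)) * D).
    apply: ler_pM; rewrite ?rnorm_ge0 ?mulr_ge0 ?rnorm_ge0 //.
    by apply: ler_pM; rewrite ?rnorm_ge0.
  by move: B B0 D D0 {aB dD P1 P2 P3 aB'} => x x0 y y0; field; rewrite !gt_eqF.
apply: (le_trans (rnormM3 _ _ _)).
rewrite -[leRHS](@divfK _ B) ?gt_eqF // mulrC [leRHS]mulrC.
rewrite [leLHS]mulrC; apply: ler_pM; rewrite ?rnorm_ge0 ?mulr_ge0 ?rnorm_ge0 //.
by rewrite -[leRHS]mulr1; apply: ler_pM; rewrite ?rnorm_ge0.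
Qed.

(** The index set of [hamiltonian] as a list; truncated subtraction makes it empty for M < r, like
    the interval. *)
Definition volume M : seq int :=
  [seq r%:Z - M%:Z + i%:Z | i <- iota 0 (M.*2.+1 - r.*2)].

Lemma uniq_volume M : uniq (volume M).
Proof. by rewrite map_inj_uniq ?iota_uniq // => i i' /addrI; case. Qed.

Lemma mem_volume M (x : int) :
  (x \in volume M) = (- M%:Z + r%:Z <= x <= M%:Z - r%:Z).
Proof.
apply/mapP/idP => [[i iM ->] | xM]; first by move: iM; rewrite mem_iota; lia.
exists (absz (x - (r%:Z - M%:Z))%R); last by lia.
by rewrite mem_iota; lia.
Qed.

Lemma hamiltonianE M : hamiltonian tau r h M = ham (volume M).
Proof.
rewrite /hamiltonian [RHS](fsbig_seq _ _ (uniq_volume M)).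
by apply: eq_fsbigl; apply/seteqP; split=> x; rewrite /= mem_volume.
Qed.

Lemma evo_cvg t j z Q : centered 0 j z Q ->
  seq_to (fun M => evo (ham (volume M)) t Q) (evolution tau r h t Q).
Proof.
move=> cQ.
have [a aP] : exists a, seq_to (fun M => evo (ham (volume M)) t Q) a.
  apply: cauchy_seq_to => e e0; have e2 : 0 < e / 2 by rewrite divr_gt0.
  have [L LP] := quasi_localT car parity trans int_h `|t| j (rnorm Q) e2.
  (* The volume reaches to M - r on each side, so from here on it contains the window of radius
     [radius r L + r]. *)
  exists (radius r L + 2 * r)%N => M M' LM LM'.
  have ag : agree r L 0 (volume M) (volume M').
    by move=> x /andP[x1 x2]; rewrite !mem_volume; lia.
  have [P [_ PM PM']] := LP (volume M) (volume M') 0 z Q t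
    (uniq_volume M) (uniq_volume M') ag (lexx _) cQ (lexx _).
  apply: (le_trans (rnorm_dist _ P _)); rewrite [leRHS]splitr lerD //.
  by rewrite rnorm_sub_sym.
rewrite (_ : evolution tau r h t Q = a) //.
rewrite /evolution /=; apply: seq_to_lim; apply: seq_to_ext aP => M.
by rewrite /evo hamiltonianE.
Qed.

(** The inner evolution of [Q] need not be local, so [evo_cvg] does not cover the outer one. But in
    volume M the evolved Y differs from [Q] by at most the distance of Y to the volume-M evolution
    of [Q] at time -t, which tends to 0. *)
Lemma evolutionK t j z Q : centered 0 j z Q ->
  evolution tau r h t (evolution tau r h (- t) Q) = Q.
Proof.
move=> cQ; have cv := evo_cvg (- t) cQ; set Y := evolution _ _ _ (- t) Q in cv *.
have yv : seq_to (fun M => evo (ham (volume M)) t Y) Q.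
  move=> e /cv[N NP]; exists N => M NM.
  rewrite -{1}(evoK (ham (volume M)) t Q) -evoB.
  apply: (le_trans (rnorm_evo _ _ (star_ham trans int_h _))).
  by rewrite rnorm_sub_sym NP.
rewrite /evolution /=; apply: seq_to_lim; apply: seq_to_ext yv => M.
by rewrite /evo hamiltonianE.
Qed.

Lemma string_correlation_small (psi psiF : {scalar A}) t n m Q1 Q2 :
  is_fock c psiF -> (forall Q, psi (evolution tau r h t Q) = psiF Q) ->
  loc n (-1) Q1 -> Theta Q1 = - Q1 -> loc 0 m Q2 -> Theta Q2 = - Q2 ->
  forall e, 0 < e -> exists K, forall k, (K <= k)%N ->
  `|psi (Q1 * string 0 (k + k)%N * tau (k + k)%N%:Z Q2)| <= e%:C%C.
Proof.
move=> fock psiE l1 o1 l2 o2 e e0.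
have e2 : 0 < e / 2 by rewrite divr_gt0.
have [K KP] := flip_correlation (- t) e2 l1 o1 l2 o2.
exists K => k Kk; set X := _ * _ * _.
(* The index j grows with k, which does no harm: it only serves the existence and the inversion of
   the infinite-volume evolution of [X]. *)
have [j cX] : exists j, centered 0 j 1 X.
  have [|j1 [l1' _]] := loc_centered l1 (z := -1); first by rewrite scaleN1r.
  have [|j2 c2] := loc_centered l2 (z := -1); first by rewrite scaleN1r.
  have [l2' _] := centered_tau (k + k) c2.
  apply: (@loc_centered (- (radius r j1 + radius r j2 + k + k)%N%:Z)
    (radius r j1 + radius r j2 + k + k)%N%:Z).
    apply: locM; first (apply: locM; last by apply: loc_string; lia).
      by apply: loc_mono l1'; lia.
    by apply: loc_mono l2'; lia.
  rewrite scale1r /X !rmorphM /= Theta_string o1 (Theta_tau parity trans _ l2) o2.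
  by rewrite raddfN /= mulrN !mulNr opprK.
have cv := evo_cvg (- t) cX; set Y := evolution _ _ _ (- t) X in cv *.
have YX : psi X = psiF Y by rewrite -psiE /Y (evolutionK t cX).
(* The threshold [K] is the same for all volumes, so the bound survives the limit in M. *)
have nY : rnorm (Y + flip k * Y * flip k) <= e / 2.
  have := seq_toB cv (seq_to_mull (- flip k) (flip k) cv).
  rewrite mulNr mulNr opprK; move/seq_to_le; apply.
  exists 0%N => M _; rewrite mulNr mulNr opprK.
  exact: (KP k _ Kk (uniq_volume M)).
have FY : psiF (Y + flip k * Y * flip k) = 2 * psiF Y.
  by rewrite raddfD /= fock_string // mulr_natl mulr2n.
have := state_bound (Y + flip k * Y * flip k) fock.1.
rewrite FY normrM normr_nat -YX => b.
have b2 : 2 * `|psi X| <= 2 * e%:C%C.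
  rewrite (le_trans b) // -(rmorph_nat (real_complex R) 2) -rmorphM lecR.
  by rewrite (le_trans (ler_wpM2l _ nY)) // (_ : 4 * (e / 2) = 2 * e) //; field.
by rewrite ler_pM2l ?ltr0n in b2.
Qed.

End ParityFlip.

Unset Implicit Arguments.
Set Strict Implicit.
Set Printing Implicit Defensive.

Theorem theorem8 (R : realType) (A : cstarAlgType R) (c : int -> A)
    (Theta : {lrmorphism A -> A}) (tau : int -> {lrmorphism A -> A})
    (psiF : {scalar A}) (n : nat) (h : A) (psi : {scalar A}) :
  is_car_algebra c ->
  is_parity c Theta ->
  is_translation c tau ->
  is_fock c psiF ->
  local_interaction c Theta n h ->
  invariant_state tau psi ->
  pure_state psi ->
  ground_state tau h psi ->
  gapped c tau n h psi ->
  string_order c Theta tau psi ->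
  forall (t : R) (n' : nat) (h' : A), local_interaction c Theta n' h' ->
    psi \o evolution tau n' h' t <> psiF.
Proof.
move=> [car _] parity trans fock _ _ _ _ _ order t n' h' int_h evE.
have psiE Q : psi (evolution tau n' h' t Q) = psiF Q.
  exact: (congr1 (fun f : A -> R[i] => f Q) evE).
move: order => -[a] -[m] -[Q1] -[Q2] -[l] order.
case: order => _ l1 l2 cvl /eqP l0.
case: l1 => o1 l1; case: l2 => o2 l2.
have small := string_correlation_small car parity trans int_h fock psiE l1 o1 l2 o2.
apply: l0; apply/eqP; rewrite -normr_eq0.
have lE : `|l| = (complex.Re `|l|)%:C%C by rewrite RRe_real ?ger0_real.
have r0 : 0 <= complex.Re `|l| by rewrite -ler0c -lE.
rewrite lE; apply/eqP; congr (_%:C%C); apply/eqP; rewrite eq_le r0 andbT.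
rewrite leNgt; apply/negP => lp.
(* A quarter each for the size of the correlator and for its distance to [l] gives |l| <= |l| /
   2. *)
have d0 : 0 < complex.Re `|l| / 4 by rewrite divr_gt0.
have [K KP] := small _ d0.
move/cvgrPdist_le: cvl => /(_ (complex.Re `|l| / 4)%:C%C).
rewrite ltcR => /(_ d0)[N _ NP].
have := NP (maxn N K) (leq_maxl _ _); have := KP (maxn N K) (leq_maxr _ _).
rewrite /= string_opE mul2n -addnn; set w := psi _ => w1 w2.
have : `|l| <= (complex.Re `|l| / 4)%:C%C + (complex.Re `|l| / 4)%:C%C.
  by rewrite -{1}(subrK w l) (le_trans (ler_normD _ _)) // lerD.
by rewrite {1}lE -rmorphD lecR; lra.
Qed.
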